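(* Let $K$ be a number field with ring of integers $\mathcal{O}_K$, and let $S$ be a subset of $\mathcal{O}_K$ with $n+1$ elements. Then the following conditions are equivalent: (1) $S$ is $n$-optimal; (2) $Vol(S)=\left(\prod_{i=1}^n i!_K\right)^2$; (3) $Vol(S)$ divides $Vol(S_1)$ for every subset $S_1\subset\mathcal{O}_K$ with $n+1$ elements.
   Context: A finite subset $S\subset\mathcal{O}_K$ is called $n$-universal if for every polynomial $P\in K[X]$ of degree at most $n$ one has $P(\mathcal{O}_K)\subset \mathcal{O}_K$ if and only if $P(S)\subset \mathcal{O}_K$. An $n$-optimal set is an $n$-universal set with exactly $n+1$ elements. The volume of a finite subset $S\subset\mathcal{O}_K$ is the principal ideal $Vol(S)=\prod_{s,s'\in S,\ s\neq s'}(s-s')$, the product being over ordered pairs. The norm of an ideal is $N(I)=|\mathcal{O}_K/I|$. The $K$-factorial of $n$ is the ideal $n!_K=\prod_{\mathfrak{p}}\mathfrak{p}^{w_{\mathfrak{p}}(n)}$, the product being over nonzero prime ideals $\mathfrak{p}$ of $\mathcal{O}_K$, where $w_{\mathfrak{p}}(n)=\sum_{i=1}^{\infty}\left[n/N(\mathfrak{p}^i)\right]$ and $[\cdot]$ is the integer part. *)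

(* Defs.v *)
From HB Require Import structures.
From mathcomp Require Import all_boot all_order all_algebra all_field.
From mathcomp Require Import finmap.
From mathcomp Require Import boolp classical_sets functions cardinality fsbigop.

Set Implicit Arguments.
Unset Strict Implicit.
Unset Printing Implicit Defensive.

Import GRing.Theory.

Local Open Scope classical_set_scope.
Local Open Scope ring_scope.

(* A number field is a [K : fieldExtType rat]. *)

Definition algInt (K : fieldExtType rat) : {pred K} :=
  fun x => `[< integralOver (intr : int -> K) x >].
Arguments algInt : clear implicits.

Lemma algInt_subring (K : fieldExtType rat) : subring_closed (algInt K).
Proof.
split=> [|x y /asboolP intx /asboolP inty|x y /asboolP intx /asboolP inty].
- by apply/asboolP; apply: integral1.
- by apply/asboolP; apply: integral_sub.
- by apply/asboolP; apply: integral_mul.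
Qed.

HB.instance Definition _ (K : fieldExtType rat) :=
  GRing.isSubringClosed.Build K (algInt K) (@algInt_subring K).

Record ringOfIntegers (K : fieldExtType rat) :=
  RingOfIntegers { roi_val :> K; _ : roi_val \in algInt K }.

HB.instance Definition _ (K : fieldExtType rat) :=
  [isSub for @roi_val K].
HB.instance Definition _ (K : fieldExtType rat) :=
  [Choice of ringOfIntegers K by <:].
HB.instance Definition _ (K : fieldExtType rat) :=
  [SubChoice_isSubComNzRing of ringOfIntegers K by <:].

Section Ideals.
Context {R : comNzRingType}.
Implicit Types (I J p : set R) (a x : R) (n : nat).

(* Ideals are the submodules of the regular module; unlike MathComp's
   [idealr_closed], this includes the unit ideal [setT]. *)
Definition is_ideal I : Prop := GRing.submod_closed ([in I] : {pred R^o}).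

Definition principal a : set R := [set a * x | x in setT].

Definition ideal_mul I J : set R :=
  [set x | exists k (a b : 'I_k -> R),
     [/\ forall i, I (a i), forall i, J (b i) & x = \sum_(i < k) a i * b i]].

Definition ideal_exp I n : set R := iter n (ideal_mul I) setT.

Definition ideal_dvd I J : Prop := exists2 H, is_ideal H & J = ideal_mul I H.

(* [fset_set] of an infinite set is empty, so an ideal of infinite index gets
   norm 0; this never happens for a nonzero ideal of a ring of integers. *)
Definition ideal_norm I : nat :=
  #|` fset_set [set [set x + y | y in I] | x in [set: R]] |.

Definition nz_primes : set (set R) :=
  [set p : set R | [/\ idealr_closed [in p], prime_idealr_closed [in p]
             & p <> [set 0]]].

(* For a nonzero prime p of a ring of integers, N(p^i) >= 2^i, so only finitely
   many terms of this sum are nonzero. *)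
Definition factorial_exponent p n : nat :=
  (\big[addn/0]_(i \in [set i | 1 <= i]) (n %/ ideal_norm (ideal_exp p i)))%N.

End Ideals.

Section NumberField.
Variable K : fieldExtType rat.
Local Notation OK := (ringOfIntegers K).

(* Only finitely many factors differ from the unit ideal: those with
   N(p) <= n. *)
Definition factorial_ideal (n : nat) : set OK :=
  \big[ideal_mul/setT]_(p \in nz_primes) ideal_exp p (factorial_exponent p n).

Definition vol (S : {fset OK}) : set OK :=
  principal (\prod_(s <- S) \prod_(s' <- S | s != s') (s - s')).

Definition n_universal (n : nat) (S : {fset OK}) : Prop :=
  forall P : {poly K}, (size P <= n.+1)%N ->
    (forall x : OK, P.[roi_val x] \in algInt K) <->
    (forall s : OK, s \in S -> P.[roi_val s] \in algInt K).

Definition n_optimal (n : nat) (S : {fset OK}) : Prop :=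
  n_universal n S /\ #|` S| = n.+1.

End NumberField.

Arguments factorial_ideal : clear implicits.

(* Main.v *)
From HB Require Import structures.
Require Import Defs.
From mathcomp Require Import all_boot all_order all_algebra all_field finmap.
From mathcomp Require Import boolp classical_sets.
From mathcomp Require Import functions cardinality fsbigop.
From mathcomp Require Import zify ring.

Set Implicit Arguments.
Unset Strict Implicit.
Unset Printing Implicit Defensive.
Import GRing.Theory.

(** Write D(x) for the product of all x i - x j with i != j, where x enumerates
    S; it generates Vol(S).

    That universality is the same as minimality of D for divisibility is a matter
    of Lagrange interpolation.  A family x is universal exactly when its Lagrange
    polynomials L_i are integer valued.  If they are, expressing the powers of the
    points of another family x' in the Lagrange basis writes the Vandermonde matrix
    of x' as that of x times an integral matrix, so D(x) divides D(x')
    ([universal_minimal]).  Conversely, moving the i-th point of x to y multiplies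
    D(x) by L_i(y)^2; if D(x) is minimal this square is integral, and L_i(y) is
    integral because the ring of integers is integrally closed
    ([minimal_universal]).

    That the minimal value is the square of the product of the factorials is
    local.  At a prime p of residue cardinality q, the valuation of D(x) is the
    sum over k >= 1 of the number of ordered pairs i != j with
    x i = x j mod p^k.  With n + 1 points in q^k classes, that number is at least
    2 * sum_(i <= n) [i / q^k] by convexity ([collision_lower_bound]), with
    equality when x i = x j mod p^k means i = j mod q^k.  Expanding i in base q and
    replacing the digits by residues and q by a uniformizer gives such a family for
    all k at once ([digit_expansion]).  Hence 2 * sum_(i <= n) w_p(i) is a lower
    bound for the valuation of D(x), reached for every single p, and a minimal D
    must reach it at every p.

    What remains is arithmetic of the ring of integers O.  It rests on finiteness
    of O / a, which gives collisions between the terms of any sequence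
    ([residues_collide]).  Collisions make nonzero primes maximal, and produce c
    in K with c p contained in O but not in p ([uniformizerP]); the integrality
    argument excluding c p contained in p is again a collision, between powers of c
    times an element of p.  Such a c describes everything at p: x lies in p^k iff
    c^k x is integral, so that valuations are additive.  A maximal ideal argument
    ([local_global]) glues the primes together and shows that Vol(S) and
    the products of factorials are determined by their exponents
    ([has_exponents_inj]). *)

(** * Ideals of a commutative ring *)

Section IdealOps.
Local Open Scope classical_set_scope.
Local Open Scope ring_scope.
Variable R : comNzRingType.
Implicit Types (I J H : set R) (x y : R).

Lemma is_idealP I : is_ideal I <->
  [/\ I 0, forall x y, I x -> I y -> I (x + y) & forall a x, I x -> I (a * x)].
Proof.
rewrite /is_ideal; split.
  case=> I0 IP; split.
  - by have := I0; rewrite inE.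
  - move=> x y Ix Iy; have := IP 1 x y; rewrite !inE scale1r; exact.
  - move=> a x Ix; have := IP a x 0; rewrite !inE /= addr0; apply=> //.
    by move: I0; rewrite inE.
case=> I0 ID IM; split; first by rewrite inE.
by move=> a x y; rewrite !inE => Ix Iy; apply: ID => //; apply: IM.
Qed.

Lemma is_ideal0 I : is_ideal I -> I 0. Proof. by case/is_idealP. Qed.
Lemma is_idealD I x y : is_ideal I -> I x -> I y -> I (x + y).
Proof. by case/is_idealP => _ + _; apply. Qed.
Lemma is_idealMl I a x : is_ideal I -> I x -> I (a * x).
Proof. by case/is_idealP => _ _; apply. Qed.
Lemma is_idealMr I a x : is_ideal I -> I x -> I (x * a).
Proof. by rewrite mulrC; apply: is_idealMl. Qed.
Lemma is_idealN I x : is_ideal I -> I x -> I (- x).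
Proof. by rewrite -mulN1r; apply: is_idealMl. Qed.
Lemma is_idealB I x y : is_ideal I -> I x -> I y -> I (x - y).
Proof. by move=> iI Ix Iy; apply: is_idealD => //; apply: is_idealN. Qed.

Lemma is_ideal_setT : is_ideal (setT : set R).
Proof. exact/is_idealP. Qed.

Lemma is_ideal_principal x : is_ideal (principal x).
Proof.
apply/is_idealP; split; first by exists 0; rewrite ?mulr0.
  by move=> _ _ [y _ <-] [z _ <-]; exists (y + z); rewrite ?mulrDr.
by move=> a _ [y _ <-]; exists (a * y); rewrite // mulrCA.
Qed.

Lemma ideal_mul_sub I J H : is_ideal H ->
  (forall a b, I a -> J b -> H (a * b)) -> ideal_mul I J `<=` H.
Proof.
move=> iH IJH _ [k [a [b [Ia Jb ->]]]].
elim/big_ind: _ => [|x y Hx Hy|i _]; [exact: is_ideal0|exact: is_idealD|exact: IJH].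
Qed.

Lemma mem_ideal_mul I J a b : I a -> J b -> ideal_mul I J (a * b).
Proof.
by move=> Ia Jb; exists 1%N, (fun=> a), (fun=> b); split => //; rewrite big_ord1.
Qed.

Lemma is_ideal_mul I J : is_ideal I -> is_ideal (ideal_mul I J).
Proof.
move=> iI; apply/is_idealP; split.
- by exists 0%N, (fun=> 0), (fun=> 0); split=> [[]|[]|] //; rewrite big_ord0.
- move=> _ _ [k [a [b [Ia Jb ->]]]] [k' [a' [b' [Ia' Jb' ->]]]].
  exists (k + k')%N,
    (fun i => match fintype.split i with inl j => a j | inr j => a' j end),
    (fun i => match fintype.split i with inl j => b j | inr j => b' j end).
  split; [by move=> i; case: fintype.split|by move=> i; case: fintype.split|].
  rewrite big_split_ord; congr (_ + _); apply: eq_bigr => i _.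
    by rewrite (unsplitK (inl i)).
  by rewrite (unsplitK (inr i)).
- move=> c _ [k [a [b [Ia Jb ->]]]]; exists k, (fun i => c * a i), b; split=> //.
    by move=> i; apply: is_idealMl.
  by rewrite mulr_sumr; apply: eq_bigr => i _; rewrite mulrA.
Qed.

Lemma is_ideal_exp I n : is_ideal I -> is_ideal (ideal_exp I n).
Proof. by move=> iI; case: n => [|n]; [exact: is_ideal_setT|exact: is_ideal_mul]. Qed.

Lemma mem_ideal_exp I x n : I x -> ideal_exp I n (x ^+ n).
Proof.
by move=> Ix; elim: n => [|n IH]; rewrite ?exprS //; exact: mem_ideal_mul.
Qed.

End IdealOps.

(** * The ring of integers inside its field *)

Section Basics.
Local Open Scope classical_set_scope.
Local Open Scope ring_scope.
Variable K : fieldExtType rat.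
Local Notation OK := (ringOfIntegers K).
Implicit Types (x y z a b : OK) (I J p : set OK).

(* These instances let the morphism lemmas recognize the coercion itself. *)
Lemma roi_val_is_zmod_morphism : zmod_morphism (@roi_val K).
Proof. by []. Qed.
Lemma roi_val_is_monoid_morphism : monoid_morphism (@roi_val K).
Proof. by []. Qed.
HB.instance Definition _ := GRing.isZmodMorphism.Build OK K (@roi_val K)
  roi_val_is_zmod_morphism.
HB.instance Definition _ := GRing.isMonoidMorphism.Build OK K (@roi_val K)
  roi_val_is_monoid_morphism.

Lemma roi_inj : injective (@roi_val K). Proof. exact: val_inj. Qed.
Lemma roi_int x : roi_val x \in algInt K. Proof. exact: (valP x). Qed.
Lemma algInt_roi (v : K) : v \in algInt K -> exists x : OK, roi_val x = v.
Proof. by move=> vP; exists (RingOfIntegers vP). Qed.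
Lemma roi_eq0 x : (roi_val x == 0) = (x == 0).
Proof. by rewrite -(rmorph0 (@roi_val K)) (inj_eq roi_inj). Qed.
Lemma roi_mulI x : x != 0 -> injective (fun y => x * y).
Proof.
move=> x0 y z /(congr1 (@roi_val K)); rewrite !rmorphM => /mulfI e.
by apply: roi_inj; apply: e; rewrite roi_eq0.
Qed.

Lemma algInt_root_monic (v : K) (q : {poly K}) :
  q \is monic -> root q v -> (forall i, q`_i \in algInt K) -> v \in algInt K.
Proof.
move=> mq rq iq; apply/asboolP; apply: (integral_root_monic mq rq).
by apply/integral_poly => i; apply/asboolP; apply: iq.
Qed.

Lemma nz_primesP p : nz_primes p ->
  [/\ is_ideal p, ~ p 1, forall x y, p (x * y) -> p x \/ p y & exists2 a, a != 0 & p a].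
Proof.
case=> [[p0 p1 pl] pM pn0]; split.
- apply/is_idealP; split; first by rewrite inE in p0.
    by move=> x y; have := pl 1 x y; rewrite !inE mul1r.
  move=> a x px; have := pl a x 0; rewrite !inE addr0.
  by rewrite inE in p0; apply.
- by move=> h; move: p1; rewrite notin_setE => /(_ h).
- move=> x y pxy; have := pM x y; rewrite !inE => /(_ pxy) /orP[]; rewrite ?inE; auto.
- apply: contrapT => h; apply: pn0; apply/seteqP; split => x /=; last first.
    by move=> ->; rewrite inE in p0.
  by move=> px; apply/eqP; apply: contrapT => /negP x0; apply: h; exists x.
Qed.

Lemma nz_primesI p : is_ideal p -> ~ p 1 ->
  (forall x y, p (x * y) -> p x \/ p y) -> (exists2 a, a != 0 & p a) -> nz_primes p.
Proof.
move=> /is_idealP[p0 pD pM] p1 pp [a a0 pa]; split.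
- split; rewrite ?inE //; first by rewrite notin_setE.
  by move=> b u v; rewrite !inE => pu pv; apply: pD => //; apply: pM.
- move=> u v; rewrite !inE => /pp[]h; apply/orP; [left|right]; by rewrite inE.
- by move=> pe; move: pa; rewrite pe /= => /eqP; rewrite (negPf a0).
Qed.
End Basics.

(** * Finiteness of residue rings *)

Section Finite.
Local Open Scope classical_set_scope.
Local Open Scope ring_scope.
Variable K : fieldExtType rat.
Local Notation OK := (ringOfIntegers K).
Implicit Types (x y z a b : OK) (I J p : set OK).

Lemma roi_mulz_eq0 x (m : int) : m != 0 -> x *~ m = 0 -> x = 0.
Proof.
move=> m0 /(congr1 (@roi_val K)); rewrite rmorphMz rmorph0 -scaler_int => /eqP.
by rewrite scaler_eq0 intr_eq0 (negPf m0) /= roi_eq0 => /eqP.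
Qed.

(** For [l] prime this is linear independence over F_l of the classes of the
    [x i] modulo [l]. *)
Definition indep_mod (l : nat) (m : nat) (x : 'I_m -> OK) :=
  forall a : 'I_m -> int, (exists z, \sum_i x i *~ a i = z *~ l) ->
  forall i, (l %| a i)%Z.

(** Infinite descent: all coefficients of an integral relation are divisible by
    [l]; the quotients satisfy the same relation, since O is torsion-free. *)
Lemma indep_mod_relation l m (x : 'I_m -> OK) : (1 < l)%N -> indep_mod l x ->
  forall a : 'I_m -> int, \sum_i x i *~ a i = 0 -> forall i, a i = 0.
Proof.
move=> l1 ind.
have descent k : forall a : 'I_m -> int, \sum_i x i *~ a i = 0 ->
    forall i, ((l ^ k)%N %| a i)%Z.
  elim: k => [|k IH] a a0 i; first by rewrite expn0 dvd1z.
  have la : forall i, (l %| a i)%Z by apply: ind; exists 0; rewrite mul0rz.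
  pose b i := (a i %/ l)%Z.
  have ab j : a j = b j * l by rewrite divzK.
  have b0 : \sum_i x i *~ b i = 0.
    apply: (@roi_mulz_eq0 _ l); first by case: (l) l1.
    rewrite mulrz_suml -[RHS]a0; apply: eq_bigr => j _.
    by rewrite -mulrzA ab.
  by rewrite ab expnSr PoszM dvdz_mul // IH.
move=> a a0 i; apply/eqP; rewrite -absz_eq0; apply: contraT => ai.
have := descent `|a i|%N a a0 i; rewrite dvdzE /= => /dvdn_leq.
by rewrite lt0n => /(_ ai); rewrite leqNgt ltn_expl.
Qed.

(** A rational relation becomes integral after clearing denominators, so
    independence modulo [l] implies independence over the rationals.  This bounds
    O / l O without an integral basis or a discriminant. *)
Lemma indep_mod_dim l m (x : 'I_m -> OK) : (1 < l)%N -> indep_mod l x ->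
  (m <= \dim {: K})%N.
Proof.
move=> l1 ind; pose X := [tuple roi_val (x i) | i < m].
suff : free X.
  by rewrite /free size_tuple => /eqP <-; apply: dimvS; apply: subvf.
apply/freeP => k k0.
pose a i := numq (k i) * \prod_(j | j != i) denq (k j).
have aE i : (a i)%:~R = k i * (\prod_j denq (k j))%:~R.
  by rewrite (bigD1 i) //= /a !rmorphM /= numqE mulrA.
have a0 : \sum_i x i *~ a i = 0.
  apply: roi_inj; rewrite rmorph_sum rmorph0.
  transitivity ((\prod_j denq (k j))%:~R *: (\sum_(i < m) k i *: X`_i)); last first.
    by rewrite k0 scaler0.
  rewrite scaler_sumr; apply: eq_bigr => i _.
  by rewrite rmorphMz -scaler_int aE scalerA mulrC -tnth_nth tnth_mktuple.
move=> i; have /eqP := indep_mod_relation l1 ind a0 i.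
rewrite -(intr_eq0 rat) aE mulf_eq0 intr_eq0 => /orP[/eqP//|/prodf_eq0[j _]].
by rewrite denq_eq0.
Qed.

Definition reps_mod a (r : seq OK) :=
  forall x, exists2 y, y \in r & exists z, x = y + a * z.

Lemma mulrz_natl (m : nat) z : z *~ m = m%:R * z.
Proof. by rewrite mulr_natl. Qed.

(** A family independent modulo [l] of maximal length spans O modulo [l]. *)
Lemma reps_mod_prime (l : nat) : prime l -> exists r, reps_mod l%:R r.
Proof.
move=> pl; have l1 := prime_gt1 pl.
pose P m := `[< exists x : 'I_m -> OK, indep_mod l x >].
have P0 : exists m, P m.
  by exists 0%N; apply/asboolP; exists (fun=> 0) => a _ [].
have Pd m : P m -> (m <= \dim {: K})%N by case/asboolP=> x /(indep_mod_dim l1).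
case: (ex_maxnP P0 Pd) => m /asboolP[x ind] mmax.
pose s (b : {ffun 'I_m -> 'I_l}) := \sum_i x i *~ (b i : nat).
exists [seq s b | b : {ffun 'I_m -> 'I_l}] => y.
pose x' (i : 'I_m.+1) := oapp x y (unlift ord0 i).
have : ~ indep_mod l x'.
  by move=> ind'; have := mmax m.+1; rewrite ltnn => H; apply/notF/H/asboolP; exists x'.
move=> /existsNP[a /not_implyP[[z az] /existsNP[i0 ai0]]].
have x'0 : x' ord0 = y by rewrite /x' unlift_none.
have x'l i : x' (lift ord0 i) = x i by rewrite /x' liftK.
have {}az : y *~ a ord0 + \sum_i x i *~ a (lift ord0 i) = z *~ l.
  by rewrite -az big_ord_recl x'0; congr (_ + _); apply: eq_bigr => i _; rewrite x'l.
have la0 : ~~ (l %| a ord0)%Z.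
  apply/negP => la0; apply: ai0.
  have ind' : forall i, (l %| a (lift ord0 i))%Z.
    apply: (ind (fun i => a (lift ord0 i))); exists (z - y *~ (a ord0 %/ l)%Z).
    by rewrite mulrzBl -mulrzA divzK // -az addrC addKr.
  by case: (unliftP ord0 i0) => [j ->|->].
have /coprimezP[[u v] /= uv] : coprimez (a ord0) l.
  by rewrite coprimez_sym coprimezE prime_coprime // -dvdzE.
(* Solving for [y] modulo [l]: [u] inverts the coefficient of [y]. *)
pose c i := - u * a (lift ord0 i).
have lz : (l : int) != 0 by case: (l) l1.
have cl i : (`|(c i %% l)%Z| < l)%N.
  by have := ltz_pmod (c i) (_ : 0 < l :> int)%R; have := modz_ge0 (c i) lz; lia.
exists (s [ffun i => Ordinal (cl i)]); first by apply/mapP; eexists; rewrite ?mem_enum.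
exists (z *~ u + y *~ v + \sum_i x i *~ (c i %/ l)%Z).
have sE : s [ffun i => Ordinal (cl i)] + (\sum_i x i *~ (c i %/ l)%Z) *~ l
          = (\sum_i x i *~ a (lift ord0 i)) *~ - u.
  rewrite !mulrz_suml -big_split /=; apply: eq_bigr => i _.
  rewrite ffunE /= gez0_abs ?modz_ge0 // -!mulrzA -mulrzDr addrC -divz_eq.
  by rewrite mulrC.
rewrite -mulrz_natl mulrzDl addrCA.
rewrite sE -[LHS]mulr1z -uv mulrzDr mulrzDl -!mulrzA.
have -> : y *~ (u * a ord0) = (z *~ l - \sum_i x i *~ a (lift ord0 i)) *~ u.
  by rewrite -az addrK -mulrzA mulrC.
by rewrite mulrzBl mulrNz -mulrzA [(l : int) * u]mulrC; ring.
Qed.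

Lemma reps_mod_nat (m : nat) : (0 < m)%N -> exists r, reps_mod m%:R r.
Proof.
elim/ltn_ind: m => m IH m0.
case: (ltnP 1 m) => m1; last first.
  have -> : m = 1%N by lia.
  by exists [:: 0] => x; exists 0; rewrite ?inE //; exists x; rewrite mul1r add0r.
have pp := pdiv_prime m1.
have [r rP] := reps_mod_prime pp.
have [|| r' rP'] := IH (m %/ pdiv m)%N.
- by rewrite ltn_Pdiv ?prime_gt1.
- by rewrite divn_gt0 ?pdiv_gt0 // dvdn_leq ?pdiv_dvd.
exists [seq y + (pdiv m)%:R * y' | y <- r, y' <- r'] => x.
have [y ry [z ->]] := rP x; have [y' ry' [z' ->]] := rP' z.
exists (y + (pdiv m)%:R * y'); first by apply/allpairsP; exists (y, y').
have mE : m%:R = (m %/ pdiv m)%:R * (pdiv m)%:R :> OK by rewrite -natrM divnK ?pdiv_dvd.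
by exists z'; rewrite mE; ring.
Qed.

(** The nonzero constant term of a suitable integral equation: when the constant
    term vanishes, the equation can be divided by the unknown. *)
Lemma dvd_int a : a != 0 -> exists2 m : nat, (0 < m)%N & exists z, m%:R = a * z.
Proof.
move=> a0; have /asboolP[q mq rq] := roi_int a.
have : q != 0 by apply: monic_neq0.
have {mq rq} := rootP rq.
pose ev (q : {poly int}) := (map_poly intr q).[a] : OK.
have evE (r : {poly int}) : (map_poly intr r).[roi_val a] = roi_val (ev r).
  rewrite /ev -horner_map -map_poly_comp; congr (_.[_]); apply: eq_map_poly => i /=.
  by rewrite rmorph_int.
rewrite evE => /eqP; rewrite roi_eq0 => /eqP.
elim/poly_ind: q => [|q c IH]; first by rewrite eqxx.
rewrite /ev rmorphD rmorphM /= map_polyX map_polyC hornerMXaddC /= -/(ev q).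
case: (eqVneq c 0) => [->|c0].
  rewrite addr0 => e qn0; apply: IH.
    by apply: (roi_mulI a0); rewrite /= mulr0 mulrC.
  by apply: contraNneq qn0 => ->; rewrite mul0r add0r.
move=> e _; exists `|c|%N; first by rewrite absz_gt0.
have {}e : c%:~R = - (ev q * a) by apply/eqP; rewrite -addr_eq0 addrC e.
case: c c0 e => c _; rewrite ?NegzE ?mulrNz -pmulrn => e /=.
  by exists (- ev q); rewrite e mulrN mulrC.
by exists (ev q); rewrite -[LHS]opprK e opprK mulrC.
Qed.

Lemma reps_mod_fin a : a != 0 -> exists r, reps_mod a r.
Proof.
move=> /dvd_int[m m0 [b mE]]; have [r rP] := reps_mod_nat m0.
exists r => x; have [y ry [z ->]] := rP x; exists y => //.
by exists (b * z); rewrite mE mulrA.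
Qed.

(** Pigeonhole in the finite ring O / a. *)
Lemma residues_collide a : a != 0 -> forall f : nat -> OK,
  exists i j, (i < j)%N /\ exists z, f j - f i = a * z.
Proof.
move=> a0 f; have [r rP] := reps_mod_fin a0.
have /choice[g gP] : forall i : nat, exists y, y \in r /\ exists z, f i = y + a * z.
  by move=> i; have [y ry yz] := rP (f i); exists y.
have : ~~ uniq [seq g i | i <- iota 0 (size r).+1].
  apply/negP => u; have := uniq_leq_size u (_ : {subset _ <= r}).
  rewrite size_map size_iota ltnn => H; apply/notF/H => _ /mapP[i _ ->].
  by case: (gP i).
move=> /(uniqPn 0)[i [j [ij]]]; rewrite size_map size_iota => jr.
rewrite !(nth_map 0%N) ?size_iota ?(ltn_trans ij) // !nth_iota ?(ltn_trans ij) //.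
rewrite !add0n => gij.
exists i, j; split => //; have [_ [z ->]] := gP i; have [_ [z' ->]] := gP j.
by exists (z' - z); rewrite gij; ring.
Qed.
End Finite.

(** * The valuation at a nonzero prime *)

Section Local.
Local Open Scope classical_set_scope.
Local Open Scope ring_scope.
Variable K : fieldExtType rat.
Local Notation OK := (ringOfIntegers K).
Implicit Types (x y z a b : OK) (I J p : set OK).

Section OnePrime.
Variable p : set OK.
Hypothesis np : nz_primes p.
Let ip : is_ideal p. Proof. by have [] := nz_primesP np. Qed.
Let p1 : ~ p 1. Proof. by have [] := nz_primesP np. Qed.
Let pM x y : p (x * y) -> p x \/ p y.
Proof. by have [_ _ + _] := nz_primesP np; apply. Qed.

Lemma nprimeM x y : ~ p x -> ~ p y -> ~ p (x * y).
Proof. by move=> px py /pM[]. Qed.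

Lemma nprimeX x n : ~ p x -> ~ p (x ^+ n).
Proof. by move=> px; elim: n => [|n IH] //; rewrite exprS; apply: nprimeM. Qed.

(** Nonzero primes are maximal: from x^i = x^j modulo p with i < j one cancels
    x^i. *)
Lemma prime_coprime_inv x : ~ p x -> exists w, p (1 - x * w).
Proof.
move=> px; have [_ _ _ [a a0 pa]] := nz_primesP np.
have [i [j [ij [z fE]]]] := residues_collide a0 (fun i => x ^+ i).
exists (x ^+ (j - i).-1).
have : p (x ^+ i * (1 - x * x ^+ (j - i).-1)).
  rewrite -exprS prednK ?subn_gt0 // mulrBr mulr1 -exprD subnKC 1?ltnW //.
  by rewrite -opprB fE; apply: is_idealN => //; apply: is_idealMr.
by case/pM => // /(nprimeX px).
Qed.

(** In the finite ring O / a, the prime p is the annihilator of some [b].  Each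
    element y of p is killed by y^i g for some i and some g outside p, because
    its powers collide.  Starting from a product of such g and multiplying in turn
    by the highest power of each representative of p that does not give 0
    yields [b]. *)
Lemma prime_annihilator a : a != 0 -> p a ->
  exists b, (forall z, b <> a * z) /\ forall y, p y -> exists z, b * y = a * z.
Proof.
move=> a0 pa; have [r rP] := reps_mod_fin a0.
pose L := [seq y <- r | `[< p y >]].
have Lp y : y \in L -> p y by rewrite mem_filter => /andP[/asboolP].
suff [b [ab bL]] : exists b, (forall z, b <> a * z) /\
    forall y, y \in L -> exists z, b * y = a * z.
  exists b; split => // y py; have [y' ry [z yE]] := rP y.
  have /bL[z' z'E] : y' \in L.
    rewrite mem_filter ry andbT; apply/asboolP.
    rewrite (_ : y' = y - a * z); last by rewrite yE addrK.
    by apply: is_idealB => //; apply: is_idealMr.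
  by exists (z' + b * z); rewrite yE mulrDr z'E; ring.
have : exists b, (forall z, b <> a * z) /\
    forall y, y \in L -> exists i z, b * y ^+ i = a * z.
  suff [g [pg gL]] : exists g, ~ p g /\
      forall y, y \in L -> exists i z, g * y ^+ i = a * z.
    by exists g; split => // z gE; apply: pg; rewrite gE; apply: is_idealMr.
  elim: (L) Lp => [|y s IH] sp; first by exists 1.
  have [|g [pg gs]] := IH; first by move=> z zs; apply: sp; rewrite inE zs orbT.
  have [i [j [ij [z fE]]]] := residues_collide a0 (fun i => y ^+ i).
  have py : p y by apply: sp; rewrite mem_head.
  (* y^j - y^i = y^i (y^(j-i) - 1), and the second factor is -1 modulo p. *)
  exists (g * (y ^+ (j - i) - 1)); split.
    apply: nprimeM => // h; apply: p1; rewrite -[1](subKr (y ^+ (j - i))).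
    apply: is_idealB => //; rewrite -(prednK (n := j - i)) ?subn_gt0 // exprS.
    exact: is_idealMr.
  move=> t; rewrite inE => /orP[/eqP->|/gs[k [z' gE]]].
    exists i, (g * z); rewrite -mulrA mulrBl mul1r -exprD subnK 1?ltnW //.
    by rewrite fE mulrCA.
  by exists k, (z' * (y ^+ (j - i) - 1)); rewrite mulrAC gE -mulrA.
move=> [b0 [ab0 bL0]].
suff: exists b, [/\ forall z, b <> a * z, exists c, b = b0 * c &
    forall y, y \in L -> exists z, b * y = a * z].
  by case=> b [ab _ bL]; exists b.
elim: (L) bL0 => [|y s IH] bL0.
  by exists b0; split => //; exists 1; rewrite mulr1.
have [|b [ab [c bE] bs]] := IH; first by move=> t ts; apply: bL0; rewrite inE ts orbT.
have exi : exists i, `[< exists z, b * y ^+ i = a * z >].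
  have [i [z yE]] := bL0 y (mem_head _ _); exists i; apply/asboolP; exists (z * c).
  by rewrite bE mulrAC yE mulrA.
case: (ex_minnP exi) => -[|i] /asboolP[z iE] imin.
  by case: (ab z); rewrite -iE expr0 mulr1.
exists (b * y ^+ i); split.
- by move=> t tE; have := imin i; rewrite ltnn => H; apply/notF/H/asboolP; exists t.
- by exists (c * y ^+ i); rewrite bE mulrA.
- move=> t; rewrite inE => /orP[/eqP->|/bs[w wE]].
    by exists z; rewrite -mulrA -exprSr.
  by exists (w * y ^+ i); rewrite mulrAC wE mulrA.
Qed.

(** The number [c] generates the inverse of [p] locally at [p], and [pi] is a
    uniformizer; [u] is their product, a unit at [p]. *)
Definition uniformizes (c : K) (pi u : OK) :=
  [/\ p pi, ~ p u, c * roi_val pi = roi_val u &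
    forall x, p x -> c * roi_val x \in algInt K].

(** Take c = b / a with b from [prime_annihilator], so that c p is contained in O
    and c is not integral.  If c p were contained in p, all c^k a would lie in O,
    and a collision of two of them modulo a would make c^j - c^i integral with
    i < j, hence c integral. *)
Lemma uniformizerP : exists c pi u, uniformizes c pi u.
Proof.
have [_ _ _ [a a0 pa]] := nz_primesP np.
have [b [ab bp]] := prime_annihilator a0 pa.
have ra0 : roi_val a != 0 by rewrite roi_eq0.
pose c := roi_val b / roi_val a.
have cp x : p x -> c * roi_val x \in algInt K.
  move=> /bp[z zE]; rewrite /c mulrAC -rmorphM zE rmorphM mulrAC divff // mul1r.
  exact: roi_int.
apply: contrapT => nex.
have cpp x : p x -> exists2 y, p y & roi_val y = c * roi_val x.
  move=> px; have [y yE] := algInt_roi (cp x px); exists y => //.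
  by apply: contrapT => py; apply: nex; exists c, x, y.
have /choice[f fP] : forall k : nat, exists y, p y /\ roi_val y = c ^+ k * roi_val a.
  elim=> [|k [y [py yE]]]; first by exists a; rewrite mul1r.
  by have [z pz zE] := cpp y py; exists z; rewrite zE yE exprS mulrA.
have [i [j [ij [z fE]]]] := residues_collide a0 f.
have cE : c ^+ j - c ^+ i = roi_val z.
  apply: (mulIf ra0); rewrite mulrBl; have [_ <-] := fP j; have [_ <-] := fP i.
  by rewrite -rmorphB fE rmorphM mulrC.
have : c \in algInt K.
  apply: (@algInt_root_monic _ _ ('X^j - ('X^i + (roi_val z)%:P))).
  - rewrite monicE lead_coefDl ?lead_coefXn // size_polyN size_polyXn.
    rewrite ltnS (leq_trans (size_polyD _ _)) // geq_max size_polyXn ij.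
    by rewrite (leq_trans (size_polyC_leq1 _)) // (leq_ltn_trans _ ij).
  - by rewrite rootE !(hornerE, hornerXn) -cE; apply/eqP; ring.
  - move=> k; rewrite coefB coefD !coefXn coefC rpredB ?rpredD ?rpred_nat //.
    by case: ifP => _; rewrite ?roi_int ?rpred0.
move=> /algInt_roi[w wE]; apply: (ab w); apply: roi_inj.
by rewrite rmorphM /= wE mulrC divfK.
Qed.

Section Uniformizer.
Variables (c : K) (pi u : OK).
Hypothesis uni : uniformizes c pi u.

(** If x w = 1 - e with e in p, multiply by the geometric sum in e to replace e
    by e^k. *)
Lemma ideal_exp_coprime k x : ~ p x -> exists w z, ideal_exp p k z /\ x * w = 1 - z.
Proof.
move=> /prime_coprime_inv[w pw]; pose e := 1 - x * w.
exists (w * \sum_(i < k) e ^+ i), (e ^+ k); split; first exact: mem_ideal_exp.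
have -> : x * (w * \sum_(i < k) e ^+ i) = (1 - e) * \sum_(i < k) e ^+ i.
  by rewrite mulrA /e; congr (_ * _); ring.
by rewrite -[RHS]opprB subrX1 -mulNr; congr (_ * _); ring.
Qed.

(** For the converse, if y = c^k x is integral then u^k x = pi^k y lies in p^k,
    and u^k is invertible modulo p^k. *)
Lemma mem_expP k x : ideal_exp p k x <-> c ^+ k * roi_val x \in algInt K.
Proof.
have [ppi pu cpi cp] := uni; split.
  elim: k x => [|k IH] x; first by rewrite mul1r roi_int.
  move=> [m [a [b [pa pb ->]]]]; rewrite rmorph_sum mulr_sumr rpred_sum // => i _.
  rewrite rmorphM /= exprS mulrACA; apply: rpredM; [exact/cp/pa|exact/IH/pb].
move=> /algInt_roi[y yE].
have iE := is_ideal_exp k ip.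
have yE' : pi ^+ k * y = u ^+ k * x.
  by apply: roi_inj; rewrite !(rmorphM, rmorphXn) /= yE -cpi exprMn; ring.
have [w [z [pz wE]]] := ideal_exp_coprime k (nprimeX (n := k) pu).
rewrite -[x](subrK (z * x)) -{1}[x]mul1r -mulrBl -wE mulrAC -yE'.
apply: is_idealD => //; last exact: is_idealMr.
by apply: is_idealMr => //; apply: is_idealMr => //; apply: mem_ideal_exp.
Qed.

Lemma prime_exp1 x : ideal_exp p 1 x <-> p x.
Proof.
split; first by apply: ideal_mul_sub => // a b pa _; apply: is_idealMr.
by move=> px; have := mem_ideal_exp 1 px; rewrite expr1.
Qed.

Definition has_val k x := ideal_exp p k x /\ ~ ideal_exp p k.+1 x.

(** Primality of [p] makes valuations additive through this description. *)
Lemma has_valP k x : has_val k x <-> exists2 y, ~ p y & roi_val y = c ^+ k * roi_val x.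
Proof.
rewrite /has_val !mem_expP; split.
  move=> [/algInt_roi[y yE] nx]; exists y => // py; apply: nx.
  by rewrite exprS -mulrA -yE; have [_ _ _] := uni; apply.
move=> [y py yE]; split; first by rewrite -yE roi_int.
by move: py; rewrite -prime_exp1 mem_expP expr1 exprS -mulrA -yE.
Qed.
End Uniformizer.

Lemma has_valM k l x y : has_val k x -> has_val l y -> has_val (k + l) (x * y).
Proof.
have [c [pi [u uni]]] := uniformizerP; rewrite !(has_valP uni).
move=> [x' px' xE] [y' py' yE]; exists (x' * y'); first exact: nprimeM.
by rewrite !rmorphM /= xE yE exprD mulrACA.
Qed.

Lemma has_val1 : has_val 0 1.
Proof. by split => //; rewrite prime_exp1. Qed.

Lemma has_val_prod (I : Type) (r : seq I) (P : pred I) (k : I -> nat) (F : I -> OK) :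
  (forall i, P i -> has_val (k i) (F i)) ->
  has_val (\sum_(i <- r | P i) k i) (\prod_(i <- r | P i) F i).
Proof.
move=> kF; elim/big_rec2: _ => [|i n x Pi]; first exact: has_val1.
by apply: has_valM; apply: kF.
Qed.

Lemma ideal_expW k l x : (k <= l)%N -> ideal_exp p l x -> ideal_exp p k x.
Proof.
elim: l => [|l IH]; first by rewrite leqn0 => /eqP->.
rewrite leq_eqVlt => /orP[/eqP-> //|kl] h; apply: IH => //.
apply: (ideal_mul_sub (is_ideal_exp l ip) _ h) => a b _; apply: is_idealMl.
exact: is_ideal_exp.
Qed.

Lemma has_val_inj k l x : has_val k x -> has_val l x -> k = l.
Proof.
move=> [pk nk] [pl nl]; apply/eqP; rewrite eqn_leq (leqNgt k) (leqNgt l).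
apply/andP; split; apply/negP => lt; first by apply: nl; apply: ideal_expW pk.
by apply: nk; apply: ideal_expW pl.
Qed.

Lemma has_val_uniformizer : exists2 pi, p pi & has_val 1 pi.
Proof.
have [c [pi [u uni]]] := uniformizerP; have [ppi pu cpi _] := uni; exists pi => //.
by apply/(has_valP uni); exists u => //; rewrite expr1.
Qed.

Lemma has_valX k n x : has_val k x -> has_val (k * n) (x ^+ n).
Proof.
move=> kx; elim: n => [|n IH]; rewrite ?muln0 ?exprS ?mulnS; first exact: has_val1.
exact: has_valM.
Qed.

(** If x were in all powers of p, a collision of powers of a uniformizer modulo x
    would put pi^i in p^(i+1). *)
Lemma has_val_exists x : x != 0 -> exists k, has_val k x.
Proof.
move=> x0; have [pi ppi vpi] := has_val_uniformizer.
suff [k nk] : exists k, ~ ideal_exp p k x.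
  have ex : exists k, `[< ~ ideal_exp p k x >] by exists k; apply/asboolP.
  case: (ex_minnP ex) => -[|m] /asboolP nm mm; first by case: nm.
  exists m; split => //; apply: contrapT => h.
  by have := mm m; rewrite ltnn => H; apply/notF/H/asboolP.
apply: contrapT => /forallNP/(_ _)/contrapT all_k.
have [i [j [ij [z fE]]]] := residues_collide x0 (fun i => pi ^+ i).
have [_ ni] := has_valX i vpi; apply: ni; rewrite mul1n.
rewrite -[pi ^+ i](subKr (pi ^+ j)) fE; have iE := is_ideal_exp i.+1 ip.
apply: is_idealB => //; last by apply: is_idealMr.
by apply: (ideal_expW ij); apply: mem_ideal_exp.
Qed.

End OnePrime.
End Local.

(** * Residue systems modulo prime powers *)

Section Residues.
Local Open Scope classical_set_scope.
Local Open Scope ring_scope.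

(** Residues are indexed by natural numbers so that digits and positions in base
    [N] can be computed with. *)
Definition complete_residues (R : comNzRingType) (I : set R) (N : nat) (t : nat -> R) :=
  (forall i j, (i < N)%N -> (j < N)%N -> I (t i - t j) -> i = j) /\
  (forall x, exists2 i, (i < N)%N & I (x - t i)).

Lemma ideal_norm_residues (R : comNzRingType) (I : set R) N t : is_ideal I ->
  complete_residues I N t -> ideal_norm I = N.
Proof.
move=> iI [tinj tcov]; rewrite /ideal_norm.
pose coset x : set R := [set x + y | y in I].
have cosetP x y : coset x = coset y <-> I (x - y).
  split=> [xy|Ixy].
    have : coset x x by exists 0; rewrite ?addr0 //; apply: is_ideal0.
    by rewrite xy => -[z Iz <-]; rewrite addrC addKr.
  apply/seteqP; split => _ [z Iz <-].
    by exists (x - y + z); [exact: is_idealD|ring].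
  by exists (z - (x - y)); [exact: is_idealB|ring].
have -> : [set [set x + y | y in I] | x in [set: R]] =
    [set` [fset coset (t (val i)) | i in 'I_N]%fset].
  apply/seteqP; split => [_ [x _ <-]|_ /imfsetP[i _ ->]]; last by exists (t i).
  have [i iN xi] := tcov x; apply/imfsetP; exists (Ordinal iN) => //=.
  exact/cosetP.
rewrite set_fsetK card_imfset /= => [|i j /cosetP/tinj ij]; last exact/val_inj/ij.
by rewrite -cardE card_ord.
Qed.

(** A covering list of minimal length has no repetition modulo [I]: of two
    congruent entries one could be dropped. *)
Lemma complete_residues_exists (R : comNzRingType) (I : set R) (r : seq R) :
  is_ideal I -> (forall x, exists2 y, y \in r & I (x - y)) ->
  exists N t, complete_residues I N t.
Proof.
move=> iI rcov.
have ex : exists N, `[< exists t, forall x, exists2 i, (i < N)%N & I (x - t i) >].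
  exists (size r); apply/asboolP; exists (nth 0 r) => x; have [y yr Iy] := rcov x.
  by exists (index y r); rewrite ?index_mem ?nth_index.
case: (ex_minnP ex) => N /asboolP[t tcov] Nmin; exists N, t; split => //.
suff H i j : (i < N)%N -> (j < N)%N -> I (t i - t j) -> ~ (i <> j).
  by move=> i j iN jN /(H i j iN jN)/contrapT.
move=> iN jN Iij /eqP ij; case: N tcov Nmin iN jN => // N tcov Nmin iN jN.
have := Nmin N; rewrite ltnn => H; apply/notF/H/asboolP.
exists (fun k => t (bump i k)) => x.
have bumpN k : k != i -> (k < N.+1)%N -> exists2 l, (l < N)%N & bump i l = k.
  move=> ki kN; exists (unbump i k); last by rewrite unbumpK // inE.
  by move: ki kN iN; rewrite /unbump; case: ltngtP => //=; lia.
have [k kN Ik] := tcov x; case: (eqVneq k i) Ik => [->|ki] Ik.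
  have [|l lN lE] := bumpN j _ jN; first by rewrite eq_sym.
  by exists l; rewrite // lE -(subrK (t i) x) -addrA; apply: is_idealD.
by have [l lN lE] := bumpN k ki kN; exists l; rewrite ?lE.
Qed.

Lemma modn_mulP q m i j : (0 < q)%N ->
  (i = j %[mod q * m])%N <-> (i = j %[mod q])%N /\ (i %/ q = j %/ q %[mod m])%N.
Proof.
move=> q0; have E k : (k %% (q * m) = (k %/ q) %% m * q + k %% q)%N.
  case: (posnP m) => [->|m0]; first by rewrite muln0 !modn0 -divn_eq.
  rewrite {1}(divn_eq k q) {1}(divn_eq (k %/ q) m) mulnDl -addnA -mulnA [(m * q)%N]mulnC.
  rewrite modnMDl modn_small // -(ltn_add2l 0) add0n.
  have := ltn_pmod (k %/ q) m0; have := ltn_pmod k q0; nia.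
rewrite !E; split=> [h|[-> ->] //].
have hq : (i %% q = j %% q)%N.
  by have := congr1 (modn^~ q) h; rewrite !modnMDl !modn_mod.
by split => //; move/eqP: h; rewrite hq eqn_add2r eqn_pmul2r // => /eqP.
Qed.

Variable K : fieldExtType rat.
Local Notation OK := (ringOfIntegers K).
Implicit Types (x y z a b : OK) (I J p : set OK).

Section OnePrime.
Variable p : set OK.
Hypothesis np : nz_primes p.
Let ip : is_ideal p. Proof. by have [] := nz_primesP np. Qed.
Let p1 : ~ p 1. Proof. by have [] := nz_primesP np. Qed.

Lemma prime_residues : exists q t, (1 < q)%N /\ complete_residues p q t.
Proof.
have [_ _ _ [a a0 pa]] := nz_primesP np; have [r rP] := reps_mod_fin a0.
have [|q [t tP]] := @complete_residues_exists _ p r ip.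
  move=> x; have [y ry [z xE]] := rP x; exists y => //.
  by rewrite xE addrC addKr; apply: is_idealMr.
exists q, t; split => //; have [_ tcov] := tP.
rewrite ltnNge; apply/negP => q1.
have [i iq Ii] := tcov 0; have [j jq Ij] := tcov 1.
have ij : i = j by lia.
apply: p1; rewrite (_ : 1 = (1 - t j) - (0 - t j)); last by ring.
by apply: is_idealB => //; rewrite -ij.
Qed.

(** Cancellation of an element of known valuation. *)
Lemma mem_expMl k l x y : has_val p k x ->
  ideal_exp p (k + l) (x * y) <-> ideal_exp p l y.
Proof.
move=> kx; split=> [h|h]; last first.
  have [c [pi [u uni]]] := uniformizerP np; move: h; rewrite !(mem_expP np uni) => h.
  rewrite rmorphM exprD mulrACA rpredM //; apply/(mem_expP np uni); by case: kx.
case: (eqVneq y 0) => [->|y0]; first by apply: is_ideal0; exact: is_ideal_exp.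
have [m ym] := has_val_exists np y0; case: (leqP l m) => lm.
  by apply: (ideal_expW np lm); case: ym.
have [_ []] := has_valM np kx ym.
by apply: (ideal_expW np _ h); rewrite -addnS leq_add2l.
Qed.

Section Digits.
Variables (q : nat) (t : nat -> OK) (pi : OK).
Hypotheses (q1 : (1 < q)%N) (tP : complete_residues p q t) (vpi : has_val p 1 pi).
Let q0 : (0 < q)%N. Proof. exact: ltnW. Qed.

(** The number with base-[q] digits d_0, d_1, ... is sent to
    t d_0 + pi * t d_1 + pi^2 * t d_2 + ..., truncated after [M] terms. *)
Fixpoint digit_expansion M i : OK :=
  if M is M'.+1 then t (i %% q)%N + pi * digit_expansion M' (i %/ q)%N else 0.

Lemma digit_expansionS M i :
  digit_expansion M.+1 i = t (i %% q)%N + pi * digit_expansion M (i %/ q)%N.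
Proof. by []. Qed.

(** The last digits must agree, since [t] is injective modulo p; after removing
    them one can divide by [pi]. *)
Lemma digit_expansion_congr M k i j : (k <= M)%N ->
  ideal_exp p k (digit_expansion M i - digit_expansion M j) <->
  (i = j %[mod q ^ k])%N.
Proof.
elim: M k i j => [|M IH] [|k] i j //; try by rewrite expn0 !modn1.
rewrite ltnS => kM; rewrite expnS modn_mulP // -(IH k) //.
rewrite !digit_expansionS opprD addrACA -mulrBr.
set d := (digit_expansion _ _ - _).
have [tinj _] := tP; have ppi : p pi by apply/(prime_exp1 np); case: vpi.
split=> [h|[->]].
  have tij : p (t (i %% q)%N - t (j %% q)%N).
    rewrite -[_ - _](addrK (pi * d)); apply: is_idealB => //; last exact: is_idealMr.
    by apply/(prime_exp1 np); apply: (ideal_expW np _ h).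
  have ij : (i %% q = j %% q)%N by apply: tinj => //; rewrite ltn_mod.
  split=> //; move: h; rewrite ij subrr add0r -add1n.
  by move/(mem_expMl _ _ vpi).
by rewrite subrr add0r -add1n => /(mem_expMl _ _ vpi).
Qed.

(** With d the digit of x modulo p, x - t d is a multiple of [pi] up to an element
    of p^(M+1), because p = (pi) + p^(M+1): for z in p, the integral number c z
    times [pi] is u z, and u is invertible modulo p^(M+1). *)
Lemma digit_expansion_cover M x :
  exists2 i, (i < q ^ M)%N & ideal_exp p M (x - digit_expansion M i).
Proof.
elim: M x => [|M IH] x; first by exists 0%N.
have [_ tcov] := tP; have [d dq pd] := tcov x.
have [c [pi' [u uni]]] := uniformizerP np.
have ppi : p pi by apply/(prime_exp1 np); case: vpi.
have [y py yE] : exists2 y, ~ p y & roi_val y = c * roi_val pi.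
  by have /(has_valP np uni)[y] := vpi; rewrite expr1; exists y.
have [w [z [pz wE]]] := ideal_exp_coprime np M.+1 py.
have [e eE] : exists e, roi_val e = c * roi_val (x - t d).
  by apply/algInt_roi; have [_ _ _] := uni; apply.
have [i iq pi_] := IH (w * e); exists (i * q + d)%N.
  by rewrite expnS; nia.
rewrite digit_expansionS modnMDl modn_small // divnMDl // divn_small // addn0.
have -> : x - (t d + pi * digit_expansion M i) =
    z * (x - t d) + pi * (w * e - digit_expansion M i).
  have : y * w * (x - t d) = pi * w * e.
    by apply: roi_inj; rewrite !rmorphM /= yE eE; ring.
  rewrite wE mulrBl mul1r => /eqP; rewrite subr_eq => /eqP h.
  by rewrite opprD addrA {1}h; ring.
have iM := is_ideal_exp M.+1 ip.
by apply: is_idealD => //; [exact: is_idealMr|rewrite -add1n; apply/(mem_expMl _ _ vpi)].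
Qed.

Lemma ideal_norm_exp M : ideal_norm (ideal_exp p M) = (q ^ M)%N.
Proof.
apply: (@ideal_norm_residues _ _ _ (digit_expansion M)); first exact: is_ideal_exp.
split=> [i j iM jM|x]; last exact: digit_expansion_cover.
by move/(digit_expansion_congr _ _ (leqnn M)); rewrite !modn_small.
Qed.

End Digits.

(** The terms with k > n vanish as q^k > k. *)
Lemma factorial_exponentE q n M : (1 < q)%N -> (n < M)%N ->
  (forall k, ideal_norm (ideal_exp p k) = (q ^ k)%N) ->
  factorial_exponent p n = (\sum_(1 <= k < M) n %/ q ^ k)%N.
Proof.
move=> q1 nM nE; rewrite /factorial_exponent.
rewrite (eq_fsbigr (fun k => n %/ q ^ k)%N); last by move=> k _; rewrite nE.
rewrite [RHS]fsbig_seq ?iota_uniq //; apply/esym/fsbig_widen => k /=.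
  by rewrite mem_index_iota => /andP[].
move=> [k1 /negP]; rewrite mem_index_iota k1 /= -leqNgt => Mk.
by apply: divn_small; rewrite (ltn_trans nM) // (leq_ltn_trans Mk) // ltn_expl.
Qed.

End OnePrime.
End Residues.

(** * From local to global *)

Section Global.
Local Open Scope classical_set_scope.
Local Open Scope ring_scope.
Variable K : fieldExtType rat.
Local Notation OK := (ringOfIntegers K).
Implicit Types (x y z a b : OK) (I J p : set OK).

(** An ideal containing [a] is determined by which elements of a system of
    representatives modulo [a] it contains. *)
Definition trace_on (r : seq OK) J : {set 'I_(size r)} :=
  [set i : 'I_(size r) | `[< J r`_i >]].

Lemma trace_on_mem a r J i x : is_ideal J -> J a ->
  (exists z, x = r`_i + a * z) -> (i < size r)%N ->
  J x <-> exists2 i' : 'I_(size r), i' = i :> nat & i' \in trace_on r J.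
Proof.
move=> iJ Ja [z ->] ir; split=> [Jx|[i' <-]].
  exists (Ordinal ir) => //; rewrite inE; apply/asboolP.
  by rewrite -[_`_ _](addrK (a * z)); apply: is_idealB => //; apply: is_idealMr.
by rewrite inE => /asboolP Ji; apply: is_idealD => //; apply: is_idealMr.
Qed.

Lemma trace_on_sub a r I J : reps_mod a r -> is_ideal I -> is_ideal J -> I a -> J a ->
  trace_on r I \subset trace_on r J -> I `<=` J.
Proof.
move=> rP iI iJ Ia Ja /fintype.subsetP IJ x Ix; have [y yr [z xE]] := rP x.
have yr' : (index y r < size r)%N by rewrite index_mem.
have E : exists z, x = r`_(index y r) + a * z by exists z; rewrite nth_index.
apply/(trace_on_mem iJ Ja E yr').
by have /(trace_on_mem iI Ia E yr')[i' i'E /IJ] := Ix; exists i'.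
Qed.

Lemma finite_ideals_containing a : a != 0 -> finite_set [set J | is_ideal J /\ J a].
Proof.
move=> a0; have [r rP] := reps_mod_fin a0.
pose g (B : {set 'I_(size r)}) : set OK :=
  [set x | exists2 i, i \in B & exists z, x = r`_i + a * z].
apply: (@sub_finite_set _ _ (g @` setT)); last exact/finite_image/finite_finset.
move=> J [iJ Ja]; exists (trace_on r J) => //; apply/seteqP; split => x.
  move=> [i iB E]; apply/(trace_on_mem iJ Ja E (ltn_ord i)); by exists i.
move=> Jx; have [y yr [z xE]] := rP x.
have yr' : (index y r < size r)%N by rewrite index_mem.
have E : exists z, x = r`_(index y r) + a * z by exists z; rewrite nth_index.
have /(trace_on_mem iJ Ja E yr')[i' i'E i'J] := Jx.
by exists i'; last rewrite i'E.
Qed.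

(** A proper ideal containing [B] whose trace is as large as possible is
    maximal. *)
Lemma nz_prime_above a B : a != 0 -> is_ideal B -> B a -> ~ B 1 ->
  exists2 p, nz_primes p & B `<=` p.
Proof.
move=> a0 iB Ba B1; have [r rP] := reps_mod_fin a0.
pose P n := `[< exists J, [/\ is_ideal J, B `<=` J, ~ J 1 & #|trace_on r J| = n] >].
have exP : exists n, P n by exists #|trace_on r B|; apply/asboolP; exists B; split.
have boundP n : P n -> (n <= size r)%N.
  by move=> /asboolP[J [_ _ _ <-]]; rewrite (leq_trans (max_card _)) // card_ord.
case: (ex_maxnP exP boundP) => n /asboolP[J [iJ BJ J1 Jn]] nmax.
have Ja := BJ _ Ba.
exists J => //; apply: nz_primesI => //; last by exists a.
move=> x y Jxy; apply: contrapT => /not_orP[Jx Jy].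
(* The ideal J + x O is strictly larger, hence contains 1; multiply by y. *)
pose J' : set OK := [set z | exists2 j, J j & exists w, z = j + x * w].
have iJ' : is_ideal J'.
  apply/is_idealP; split.
  - by exists 0; [exact: is_ideal0|exists 0; rewrite mulr0 addr0].
  - move=> _ _ [j Jj [w ->]] [j' Jj' [w' ->]]; exists (j + j'); first exact: is_idealD.
    by exists (w + w'); ring.
  - move=> c _ [j Jj [w ->]]; exists (c * j); first exact: is_idealMl.
    by exists (c * w); ring.
have JJ' : J `<=` J' by move=> z Jz; exists z => //; exists 0; rewrite mulr0 addr0.
have J'x : J' x by exists 0; [exact: is_ideal0|exists 1; rewrite mulr1 add0r].
case: (pselect (J' 1)) => [[j Jj [w wE]]|J'1].
  apply: Jy; rewrite -[y]mul1r wE mulrDl; apply: is_idealD => //; first exact: is_idealMr.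
  by rewrite mulrAC; apply: is_idealMr.
apply: Jx; apply: (trace_on_sub rP iJ' iJ (JJ' _ Ja) Ja _ J'x).
have sub : trace_on r J \subset trace_on r J'.
  by apply/fintype.subsetP => i; rewrite !inE => /JJ'.
suff /eqP <- : trace_on r J == trace_on r J' by [].
rewrite eqEcard sub Jn nmax //; apply/asboolP; exists J'; split => //.
by move=> z Bz; apply: (JJ' _ (BJ _ Bz)).
Qed.

(** Otherwise the proper ideal of all [a] with [a * x] in [B] would be contained in
    a nonzero prime, which the given [u] prevents. *)
Lemma local_global B x : is_ideal B -> (exists2 b, b != 0 & B b) ->
  (forall p, nz_primes p -> exists2 u, ~ p u & B (u * x)) -> B x.
Proof.
move=> iB [b b0 Bb] loc; pose A : set OK := [set a | B (a * x)].
have iA : is_ideal A.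
  apply/is_idealP; split; rewrite /A /=.
  - by rewrite mul0r; exact: is_ideal0.
  - by move=> y z; rewrite mulrDl; exact: is_idealD.
  - by move=> c y; rewrite -mulrA; exact: is_idealMl.
apply: contrapT => Bx.
have [||p np Ap] := nz_prime_above b0 iA; [exact: is_idealMr|by rewrite /A /= mul1r|].
by have [u pu /Ap] := loc p np.
Qed.

Lemma ideal_exp_mem_mul p k l x y : nz_primes p ->
  ideal_exp p k x -> ideal_exp p l y -> ideal_exp p (k + l) (x * y).
Proof.
move=> np; have [c [pi [u uni]]] := uniformizerP np; rewrite !(mem_expP np uni) => kx ly.
by rewrite rmorphM exprD mulrACA rpredM.
Qed.

(** Both [u] and [v] are multiples by c^k: of [d] and of [x] respectively. *)
Lemma local_divisor p k d x : nz_primes p -> has_val p k d -> ideal_exp p k x ->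
  exists u v, ~ p u /\ u * x = d * v.
Proof.
move=> np; have [c [pi [u' uni]]] := uniformizerP np.
rewrite (has_valP np uni) (mem_expP np uni) => -[u pu uE] /algInt_roi[v vE].
exists u, v; split => //; apply: roi_inj.
by rewrite !rmorphM /= uE vE; ring.
Qed.

(** Unique factorization in usable form: the exponents decide membership, and at
    each prime they are attained by an element of the ideal.  The last condition
    is what [local_global] asks for. *)
Definition has_exponents (e : set OK -> nat) I :=
  [/\ is_ideal I, forall x, I x <-> forall p, nz_primes p -> ideal_exp p (e p) x,
      forall p, nz_primes p -> exists2 y, I y & has_val p (e p) y &
      exists2 b, b != 0 & I b].

Lemma eq_exponents e f I : (forall p, nz_primes p -> e p = f p) ->
  has_exponents e I -> has_exponents f I.
Proof.
move=> ef [iI IP Iv I0]; split=> // [x|p np]; last by rewrite -ef //; apply: Iv.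
by rewrite IP; split=> h p np; have := h p np; rewrite ef.
Qed.

Lemma has_exponents_inj e I J : has_exponents e I -> has_exponents e J -> I = J.
Proof. by move=> [_ IP _ _] [_ JP _ _]; apply/seteqP; split => x; rewrite IP JP. Qed.

Lemma has_exponentsT : has_exponents (fun=> 0%N) setT.
Proof.
split=> //; first exact: is_ideal_setT; last by exists 1; rewrite ?oner_eq0.
by move=> p np; exists 1 => //; apply: has_val1.
Qed.

(** Elements y of I and z of J attaining the exponents at p give a product
    attaining the sum, and [local_divisor] shows that anything of large enough
    valuation is locally a multiple of y z. *)
Lemma has_exponents_mul e f I J : has_exponents e I -> has_exponents f J ->
  has_exponents (fun p => e p + f p)%N (ideal_mul I J).
Proof.
move=> [iI IP Iv [y0 y00 Iy0]] [iJ JP Jv [z0 z00 Jz0]].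
have yz0 : exists2 b, b != 0 & ideal_mul I J b.
  exists (y0 * z0); last exact: mem_ideal_mul.
  by apply: contra_neq z00 => h; apply: (roi_mulI y00); rewrite /= mulr0.
split=> //; first exact: is_ideal_mul; last first.
  move=> p np; have [y Iy vy] := Iv p np; have [z Jz vz] := Jv p np.
  by exists (y * z); [exact: mem_ideal_mul|exact: has_valM].
move=> x; split=> [IJx p np|loc].
  have [ip _ _ _] := nz_primesP np.
  apply: ideal_mul_sub IJx; first exact: is_ideal_exp.
  by move=> a b /IP/(_ p np) pa /JP/(_ p np) pb; apply: ideal_exp_mem_mul.
apply: local_global => //; first exact: is_ideal_mul.
move=> p np; have [y Iy vy] := Iv p np; have [z Jz vz] := Jv p np.
have [u [v [pu uE]]] := local_divisor np (has_valM np vy vz) (loc p np).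
exists u => //; rewrite uE; apply: is_idealMr; first exact: is_ideal_mul.
exact: mem_ideal_mul.
Qed.

Lemma has_exponents_prod (T : Type) (r : seq T) (e : T -> set OK -> nat)
    (I : T -> set OK) :
  (forall i, has_exponents (e i) (I i)) ->
  has_exponents (fun p => \sum_(i <- r) e i p)%N (\big[ideal_mul/setT]_(i <- r) I i).
Proof.
move=> eI; elim: r => [|i r IH].
  by rewrite big_nil; apply: eq_exponents has_exponentsT => p _; rewrite big_nil.
rewrite big_cons; apply: eq_exponents (has_exponents_mul (eI i) IH) => p _.
by rewrite big_cons.
Qed.

Lemma has_exponents_exp e I n : has_exponents e I ->
  has_exponents (fun p => n * e p)%N (ideal_exp I n).
Proof.
move=> eI; elim: n => [|n IH].
  by apply: eq_exponents has_exponentsT => p _.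
by apply: eq_exponents (has_exponents_mul eI IH) => p _; rewrite mulSn.
Qed.

Lemma nz_prime_separation p q : nz_primes p -> nz_primes q -> p <> q ->
  exists2 g, p g & ~ q g.
Proof.
move=> np nq pq; apply: contrapT => nex; apply: pq.
have pq : p `<=` q by move=> x px; apply: contrapT => qx; apply: nex; exists x.
apply/seteqP; split => // x qx; apply: contrapT => /(prime_coprime_inv np)[w /pq qw].
have [iq q1 _ _] := nz_primesP nq; apply: q1.
by rewrite -[1](subrK (x * w)); apply: is_idealD => //; apply: is_idealMr.
Qed.

Lemma has_exponents_prime p : nz_primes p -> has_exponents (fun q => (q == p) : nat) p.
Proof.
move=> np; have [ip p1 _ p0] := nz_primesP np; split=> //.
- move=> x; split=> [px q nq|/(_ p np)]; last by rewrite eqxx => /(prime_exp1 np).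
  by case: eqVneq => [->|_] //; apply/(prime_exp1 np).
- move=> q nq; case: eqVneq => [->|/eqP qp].
    by have [pi ppi vpi] := has_val_uniformizer np; exists pi.
  have [g pg qg] := nz_prime_separation np nq (nesym qp); exists g => //.
  by split=> //; rewrite (prime_exp1 nq).
Qed.

Lemma has_exponents_principal e d : d != 0 ->
  (forall p, nz_primes p -> has_val p (e p) d) -> has_exponents e (principal d).
Proof.
move=> d0 de; have iD := is_ideal_principal d.
have Dd : principal d d by exists 1; rewrite ?mulr1.
split=> //; [|by move=> p /de; exists d|by exists d].
move=> x; split=> [[y _ <-] p np|loc].
  have [ip _ _ _] := nz_primesP np; apply: is_idealMr; first exact: is_ideal_exp.
  by have [] := de p np.
apply: local_global => //; first by exists d.
move=> p np; have [u [v [pu uE]]] := local_divisor np (de p np) (loc p np).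
by exists u => //; rewrite uE; exists v.
Qed.

Lemma factorial_natr_neq0 n : n`!%:R != 0 :> OK.
Proof.
apply/eqP => h; have : (1 : OK) = 0.
  apply: (@roi_mulz_eq0 _ _ n`!%:Z); last by rewrite -pmulrn.
  by rewrite -lt0n fact_gt0.
by apply/eqP; rewrite oner_eq0.
Qed.

(** A nonzero exponent forces q <= n, so two of the n + 1 integers 0, ..., n are
    congruent modulo p and their difference divides n!. *)
Lemma factorial_exponent_gt0 p n : nz_primes p -> factorial_exponent p n <> 0%N ->
  p n`!%:R.
Proof.
move=> np; have [ip _ _ _] := nz_primesP np.
have [q [t [q1 tP]]] := prime_residues np; have [pi _ vpi] := has_val_uniformizer np.
rewrite (factorial_exponentE q1 (leqnn n.+1) (ideal_norm_exp np q1 tP vpi)) => sn0.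
have qn : (q <= n)%N.
  rewrite leqNgt; apply/negP => nq; apply: sn0; rewrite big_nat big1 // => k /andP[k1 _].
  by apply: divn_small; rewrite (leq_trans nq) // -{1}(expn1 q) leq_exp2l.
have [_ tcov] := tP.
have /choice[d dP] : forall i : 'I_n.+1, exists d : 'I_q, p (i%:R - t d).
  by move=> i; have [d dq pd] := tcov i%:R; exists (Ordinal dq).
have : ~ injective d.
  by move/leq_card; rewrite !card_ord ltnNge qn.
move=> /existsNP[i /existsNP[j /not_implyP[dij /eqP ij]]].
wlog lij : i j dij ij / (i < j)%N.
  move=> H; case: (ltngtP i j) => [/H|/H|/val_inj/eqP]; first exact.
    by rewrite eq_sym; apply.
  by rewrite (negPf ij).
have pij : p (j - i)%:R.
  rewrite natrB 1?ltnW // (_ : _ - _ = (j%:R - t (d j)) - (i%:R - t (d j))); last by ring.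
  by apply: is_idealB => //; rewrite -dij.
have /dvdnP[m ->] : (j - i %| n`!)%N.
  by apply: dvdn_fact; rewrite subn_gt0 lij /= (leq_trans (leq_subr _ _)) // -ltnS.
by rewrite natrM; apply: is_idealMl.
Qed.

(** Only finitely many primes contain n!, so the finitely supported product is a
    genuine product. *)
Lemma has_exponents_factorial n :
  has_exponents (fun p => factorial_exponent p n) (factorial_ideal K n).
Proof.
rewrite /factorial_ideal.
have finA : finite_set (nz_primes `&`
    (fun p => ideal_exp p (factorial_exponent p n)) @^-1` [set~ (setT : set OK)]).
  apply: sub_finite_set (finite_ideals_containing (factorial_natr_neq0 n)).
  move=> p [np /= pn].
  have [ip _ _ _] := nz_primesP np; split=> //; apply: factorial_exponent_gt0 => // w0.
  by apply: pn; rewrite w0.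
case: finite_supportP => [|X XP XT _]; first by move=> /(_ finA).
pose e p q := (factorial_exponent p n * ((q == p) && `[< nz_primes p >]))%N.
(* The test for primality makes the exponents meaningful for every index. *)
have -> : \big[ideal_mul/setT]_(p <- X) ideal_exp p (factorial_exponent p n) =
    \big[ideal_mul/setT]_(p <- X)
      (if `[< nz_primes p >] then ideal_exp p (factorial_exponent p n) else setT).
  by apply: eq_big_seq => p /XP np; rewrite asboolT.
apply: (@eq_exponents (fun q => \sum_(p <- X) e p q)%N); last first.
  apply: has_exponents_prod => p; case: asboolP => np.
    apply: eq_exponents (has_exponents_exp _ (has_exponents_prime np)) => q _.
    by rewrite /e asboolT // andbT.
  by apply: eq_exponents has_exponentsT => q _; rewrite /e asboolF // andbF muln0.
move=> q nq; case: (boolP (q \in X)) => qX.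
  rewrite (bigD1_seq q) ?fset_uniq //= {1}/e eqxx asboolT //= muln1.
  rewrite big1 ?addn0 // => p pq.
  by rewrite /e eq_sym (negPf pq) muln0.
rewrite big_seq big1; last first.
  by move=> p pX; rewrite /e; case: eqVneq => [qp|]; [rewrite qp pX in qX|rewrite muln0].
have := XT q nq qX; case: factorial_exponent => // m mT.
have [iq q1 _ _] := nz_primesP nq; case: q1; apply/(prime_exp1 nq).
by apply: (@ideal_expW _ _ nq 1 m.+1) => //; rewrite mT.
Qed.
End Global.

(** * Counting collisions between residues *)

Section Counting.
Local Open Scope nat_scope.

(** Closed form of the minimal number of collisions; t = m / N is the floor of the
    average class size. *)
Lemma sum_divn N m : 0 < N ->
  (\sum_(i < m) i %/ N).*2 + N * (m %/ N * (m %/ N).+1) = (m %/ N * m).*2.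
Proof.
move=> N0; elim: m => [|m IH]; first by rewrite big_ord0 div0n !mul0n muln0.
rewrite big_ord_recr /= doubleD.
set S := (\sum_(i < m) _).*2 in IH *; set t := m %/ N in IH *.
have mE := divn_eq m N; have rN := ltn_pmod m N0; rewrite -/t in mE.
set r := m %% N in mE rN.
case: (ltngtP r.+1 N) => rN'; last 2 first.
- by lia.
- have -> : m.+1 %/ N = t.+1.
    by rewrite mE -addnS rN' -mulSnr mulnK.
  by nia.
have -> : m.+1 %/ N = t.
  by rewrite mE -addnS divnMDl // divn_small // addn0.
by nia.
Qed.

Lemma offdiag_sum m (F : 'I_m -> 'I_m -> nat) :
  \sum_i \sum_j F i j = \sum_i F i i + \sum_i \sum_(j | i != j) F i j.
Proof.
rewrite -big_split; apply: eq_bigr => i _; rewrite (bigD1 i) //=; congr (_ + _).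
by apply: eq_bigl => j; rewrite eq_sym.
Qed.

(** With class sizes s, sum (s - t) (s - t - 1) >= 0 for every integer t; taking
    t = m / N gives the bound of [sum_divn]. *)
Lemma collision_lower_bound N m (cl : 'I_m -> 'I_N) :
  (\sum_(i < m) i %/ N).*2 <= \sum_i \sum_(j | i != j) (cl i == cl j).
Proof.
case: m cl => [|m'] cl; first by rewrite big_ord0.
have N0 : 0 < N by apply: leq_ltn_trans (ltn_ord (cl ord0)).
move: {m'}(m'.+1) cl => m cl.
pose mc c := \sum_i (cl i == c : nat).
have mcE : \sum_c mc c = m.
  transitivity (\sum_(i < m) 1); last by rewrite sum1_card card_ord.
  rewrite /mc exchange_big /=; apply: eq_bigr => i _.
  by rewrite (bigD1 (cl i)) //= eqxx big1 // => c; rewrite eq_sym => /negPf->.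
have sqE : \sum_i \sum_j (cl i == cl j : nat) = \sum_c mc c * mc c.
  under [RHS]eq_bigr => c _ do rewrite /mc big_distrlr /=.
  rewrite [RHS]exchange_big /=; apply: eq_bigr => i _; rewrite [RHS]exchange_big /=.
  apply: eq_bigr => j _; rewrite (bigD1 (cl i)) //= eqxx mul1n eq_sym big1 ?addn0 //.
  by move=> c; rewrite eq_sym => /negPf->.
have diag : \sum_i (cl i == cl i : nat) = m.
  by under eq_bigr do rewrite eqxx; rewrite sum1_card card_ord.
have := offdiag_sum (fun i j => (cl i == cl j : nat)); rewrite diag sqE => sE.
set t := m %/ N; have := sum_divn m N0; rewrite -/t.
have : \sum_(c < N) t.*2.+1 * mc c <= \sum_(c < N) (mc c * mc c + t * t.+1).
  apply: leq_sum => c _; move: (mc c) => s.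
  case: (leqP s t) => [/subnK|/subnK] <-.
    by set d := (t - s)%N; nia.
  by set d := (s - t.+1)%N; nia.
rewrite -big_distrr mcE big_split /= sum_nat_const card_ord sE.
move: (\sum_i \sum_(j | i != j) _) => O. move: (\sum_(i < m) _) => S. nia.
Qed.

Lemma count_congruent N m : 0 < N -> \sum_(i < m) (i == m %[mod N] : nat) = m %/ N.
Proof.
move=> N0; elim/ltn_ind: m => m IH.
case: (ltnP m N) => mN.
  rewrite divn_small // big1 // => i _; rewrite !modn_small //; last exact: ltn_trans mN.
  by rewrite ltn_eqF.
have mE : m = m - N + N by rewrite subnK.
rewrite -(big_mkord xpredT (fun i => (i == m %[mod N] : nat))).
rewrite (big_cat_nat (n := m - N)) ?leq_subr //= [X in _ + X]big_ltn; last by lia.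
(* Among the last N indices only m - N is congruent to m. *)
have mm : m - N = m %[mod N] by rewrite {2}mE modnDr.
have -> : \sum_((m - N).+1 <= i < m) (i == m %[mod N] : nat) = 0.
  rewrite big_nat big1 // => i /andP[i1 i2]; apply/eqP; rewrite eqb0; apply/negP => im.
  have : N %| m - i by rewrite -eqn_mod_dvd 1?eq_sym // ltnW.
  by move=> /dvdn_leq; lia.
rewrite mm eqxx addn0.
rewrite big_mkord.
rewrite (eq_bigr (fun i : 'I_(m - N) => (i == m - N %[mod N] : nat))); last first.
  by move=> i _; rewrite mm.
by rewrite IH; [rewrite [in RHS]mE divnDr // divnn N0|lia].
Qed.

(** Reduction modulo [N] spreads 0, ..., m - 1 evenly over the classes: the index i
    is congruent to exactly i / N smaller ones. *)
Lemma collision_congruent N m : 0 < N ->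
  \sum_(i < m) \sum_(j < m | i != j) (i == j %[mod N] : nat) = (\sum_(i < m) i %/ N).*2.
Proof.
move=> N0; have := offdiag_sum (fun i j : 'I_m => (i == j %[mod N] : nat)).
have -> : \sum_(i < m) (i == i %[mod N] : nat) = m.
  by under eq_bigr do rewrite eqxx; rewrite sum1_card card_ord.
suff -> : \sum_(i < m) \sum_(j < m) (i == j %[mod N] : nat) =
    m + (\sum_(i < m) i %/ N).*2.
  by move/addnI.
elim: m => [|m IH]; first by rewrite !big_ord0.
rewrite !big_ord_recr /=.
under eq_bigr do rewrite big_ord_recr /=.
rewrite big_split /= IH count_congruent // eqxx.
under [X in _ + (X + _)]eq_bigr do rewrite eq_sym.
by rewrite count_congruent //; move: (\sum_(i < m) _) (m %/ N) => S t /=; lia.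
Qed.

(** A valuation is the number of powers of p, of exponent at least 1, that contain
    the element. *)
Lemma sum_leq_minn v M : \sum_(1 <= k < M) (k <= v : nat) = minn v M.-1.
Proof.
case: M => [|M]; first by rewrite big_geq // minn0.
elim: M => [|M IH]; first by rewrite big_geq // minn0.
by rewrite big_nat_recr //= IH /=; case: leqP; lia.
Qed.
End Counting.

(** * Products of differences at one prime *)

Section Differences.
Local Open Scope classical_set_scope.
Local Open Scope ring_scope.
Variable K : fieldExtType rat.
Local Notation OK := (ringOfIntegers K).

Definition diff_prod (R : comNzRingType) n (x : 'I_n -> R) : R :=
  \prod_i \prod_(j | i != j) (x i - x j).

Lemma diff_prod_neq0 n (x : 'I_n -> OK) : injective x -> diff_prod x != 0.
Proof.
move=> ix; rewrite -roi_eq0 /diff_prod rmorph_prod; apply/prodf_neq0 => i _.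
rewrite /= rmorph_prod; apply/prodf_neq0 => j ij.
by rewrite roi_eq0 subr_eq0; apply: contra_neq ij => /ix.
Qed.

Section OnePrime.
Variable p : set OK.
Hypothesis np : nz_primes p.

Lemma mem_exp_leq k v y : has_val p v y -> `[< ideal_exp p k y >] = (k <= v)%N.
Proof.
move=> [pv nv]; apply/asboolP/idP => [pk|kv]; last exact: (ideal_expW np kv).
by rewrite leqNgt; apply/negP => vk; apply: nv; apply: (ideal_expW np vk).
Qed.

Lemma diff_prod_val n (x : 'I_n -> OK) : injective x -> exists v : 'I_n -> 'I_n -> nat,
  (forall i j, i != j -> has_val p (v i j) (x i - x j)) /\
  has_val p (\sum_i \sum_(j | i != j) v i j) (diff_prod x).
Proof.
move=> ix.
have /choice[v vP] : forall ij : 'I_n * 'I_n, exists k,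
    ij.1 != ij.2 -> has_val p k (x ij.1 - x ij.2).
  move=> [i j] /=; case: (eqVneq i j) => [_|ij]; first by exists 0%N.
  have [|k kP] := @has_val_exists _ _ np (x i - x j); last by exists k.
  by rewrite subr_eq0; apply: contra_neq ij => /ix.
exists (fun i j => v (i, j)); split => [i j ij|]; first exact: vP (i, j) ij.
by do 2?[apply: has_val_prod => // ? ?]; exact: vP (_, _) _.
Qed.

(** The exponents are regrouped by powers of p, as collisions are counted modulo
    one power at a time. *)
Lemma factorial_exponent_sum q n : (1 < q)%N ->
  (forall k, ideal_norm (ideal_exp p k) = (q ^ k)%N) ->
  (\sum_(1 <= i < n.+1) factorial_exponent p i =
   \sum_(1 <= k < n.+1) \sum_(i < n.+1) i %/ q ^ k)%N.
Proof.
move=> q1 nE; under [RHS]eq_bigr => k _.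
  rewrite -(big_mkord xpredT (fun i => i %/ q ^ k)%N) big_ltn // div0n add0n; over.
rewrite exchange_big /= !big_nat; apply: eq_bigr => i /andP[_ i_n].
by rewrite (factorial_exponentE q1 i_n nE).
Qed.

(** Only the congruences modulo p^k with k <= n are counted: the others contribute
    nothing to the factorials. *)
Lemma diff_prod_val_ge n (x : 'I_n.+1 -> OK) d :
  injective x -> has_val p d (diff_prod x) ->
  (2 * \sum_(1 <= i < n.+1) factorial_exponent p i <= d)%N.
Proof.
move=> ix vd; have [v [vP /(has_val_inj np vd) ->]] := diff_prod_val ix.
have [q [t [q1 tP]]] := prime_residues np; have [pi _ vpi] := has_val_uniformizer np.
have nE := ideal_norm_exp np q1 tP vpi.
rewrite (factorial_exponent_sum _ q1 nE) mul2n.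
have -> : (\sum_(1 <= k < n.+1) \sum_(i < n.+1) i %/ q ^ k).*2 =
   (\sum_(1 <= k < n.+1) (\sum_(i < n.+1) i %/ q ^ k).*2)%N.
  by rewrite -mul2n big_distrr /=; apply: eq_bigr => k _; rewrite mul2n.
apply: (@leq_trans
  (\sum_(1 <= k < n.+1) \sum_i \sum_(j | i != j) (k <= v i j))%N); last first.
  rewrite exchange_big /=; apply: leq_sum => i _; rewrite exchange_big /=.
  by apply: leq_sum => j _; rewrite sum_leq_minn geq_minl.
apply: leq_sum => k _.
have ik : is_ideal (ideal_exp p k) by apply: is_ideal_exp; have [] := nz_primesP np.
have /choice[cl clP] : forall i, exists c : 'I_(q ^ k),
    ideal_exp p k (x i - digit_expansion q t pi k c).
  move=> i; have [c cq cE] := digit_expansion_cover np q1 tP vpi k (x i).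
  by exists (Ordinal cq).
apply: leq_trans (collision_lower_bound cl) _.
apply: leq_sum => i _; apply: leq_sum => j ij; case: eqP => // cij.
rewrite -(mem_exp_leq k (vP _ _ ij)) asboolT //.
rewrite (_ : x i - x j = (x i - digit_expansion q t pi k (cl i)) -
                         (x j - digit_expansion q t pi k (cl j))); last first.
  by rewrite cij; ring.
exact: (is_idealB ik (clP i) (clP j)).
Qed.

(** The digit expansions with n + 1 digits are pairwise distinct modulo p^(n+1), as
    q^(n+1) > n, so their congruences modulo p, ..., p^n count everything. *)
Lemma optimal_family n : exists2 x : 'I_n.+1 -> OK, injective x &
  has_val p (2 * \sum_(1 <= i < n.+1) factorial_exponent p i)%N (diff_prod x).
Proof.
have [q [t [q1 tP]]] := prime_residues np; have [pi _ vpi] := has_val_uniformizer np.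
have nE := ideal_norm_exp np q1 tP vpi.
pose x (i : 'I_n.+1) := digit_expansion q t pi n.+1 i.
have congr k i j : (k <= n.+1)%N -> ideal_exp p k (x i - x j) <-> (i = j %[mod q ^ k])%N.
  exact: digit_expansion_congr.
have small (i : 'I_n.+1) : (i < q ^ n.+1)%N.
  by apply: (ltn_trans (ltn_ord i)); apply: ltn_expl.
have sep i j : i != j -> ~ ideal_exp p n.+1 (x i - x j).
  by move=> /eqP ij /(congr _ _ _ (leqnn _)); rewrite !modn_small // => /val_inj.
have ix : injective x.
  move=> i j xij; apply/eqP; apply: contraT => /sep; rewrite xij subrr; case.
  by apply: is_ideal0; apply: is_ideal_exp; have [] := nz_primesP np.
exists x => //; have [v [vP vD]] := diff_prod_val ix.
suff -> : (2 * \sum_(1 <= i < n.+1) factorial_exponent p i)%N =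
          (\sum_i \sum_(j | i != j) v i j)%N by [].
apply/esym.
rewrite (factorial_exponent_sum _ q1 nE) big_distrr /=.
transitivity (\sum_(1 <= k < n.+1) \sum_i \sum_(j | i != j) (k <= v i j))%N.
  rewrite exchange_big /=; apply: eq_bigr => i _; rewrite exchange_big /=.
  apply: eq_bigr => j ij; rewrite sum_leq_minn; apply/esym/minn_idPl => /=.
  rewrite -ltnS ltnNge; apply/negP => nv; apply: (sep i j ij).
  by have [h _] := vP i j ij; apply: (ideal_expW np nv).
rewrite !big_nat; apply: eq_bigr => k /andP[_ kn].
rewrite mul2n -collision_congruent ?expn_gt0 1?ltnW //.
apply: eq_bigr => i _; apply: eq_bigr => j ij; congr nat_of_bool.
rewrite -(mem_exp_leq k (vP _ _ ij)).
by apply/asboolP/eqP => h; apply/(congr _ _ _ (ltnW kn)).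
Qed.
End OnePrime.
End Differences.

(** * Products of differences and Vandermonde determinants *)

Section DiffProd.
Local Open Scope ring_scope.

(** The last factor does not see the point of index [i]. *)
Lemma diff_prodD1 (R : comNzRingType) n (x : 'I_n -> R) i :
  diff_prod x = \prod_(j | j != i) (x i - x j) * \prod_(j | j != i) (x j - x i) *
     \prod_(k | k != i) \prod_(j | (k != j) && (j != i)) (x k - x j).
Proof.
rewrite /diff_prod (bigD1 i) //= -mulrA -big_split /=; congr (_ * _).
  by apply: eq_bigl => j; rewrite eq_sym.
by apply: eq_bigr => k ki; rewrite (bigD1 i).
Qed.

(** The sign is kept as a product since only its independence of [x] matters. *)
Lemma diff_prod_Vandermonde (R : comNzRingType) n (x : 'I_n -> R) :
  diff_prod x = \det (Vandermonde n (\row_i x i)) ^+ 2 *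
                \prod_(i < n) \prod_(j < n | (i < j)%N) -1.
Proof.
have -> : \det (Vandermonde n (\row_i x i)) =
    \prod_(i < n) \prod_(j < n | (i < j)%N) (x j - x i).
  by rewrite det_Vandermonde; do 2![apply: eq_bigr => ? _]; rewrite !mxE.
have -> : diff_prod x = \prod_(i < n) \prod_(j < n | (i < j)%N) (x i - x j) *
                        \prod_(i < n) \prod_(j < n | (j < i)%N) (x i - x j).
  rewrite -big_split; apply: eq_bigr => i _ /=.
  rewrite (bigID (fun j : 'I_n => (i < j)%N)) /=; congr (_ * _); apply: eq_bigl => j.
    by rewrite -val_eqE /=; case: ltngtP.
  by rewrite -val_eqE /=; case: ltngtP.
rewrite [X in _ * X](exchange_big_dep xpredT) //= expr2 -mulrA mulrC; congr (_ * _).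
rewrite -big_split; apply: eq_bigr => i _ /=; rewrite -big_split /=.
by apply: eq_bigr => j _; rewrite mulrN1 opprB.
Qed.
End DiffProd.

(** * Universal and minimal families *)

Section Lagrange.
Local Open Scope classical_set_scope.
Local Open Scope ring_scope.
Variable K : fieldExtType rat.
Local Notation OK := (ringOfIntegers K).
Variables (n : nat) (x : 'I_n.+1 -> OK).
Hypothesis ix : injective x.
Implicit Types (i j : 'I_n.+1) (y : OK).

Definition lagrange_poly i : {poly K} :=
  \prod_(j | j != i) ((roi_val (x i - x j))^-1 *: ('X - (roi_val (x j))%:P)).

Lemma lagrange_horner i v :
  (lagrange_poly i).[v] = \prod_(j | j != i) ((v - roi_val (x j)) / roi_val (x i - x j)).
Proof.
by rewrite /lagrange_poly horner_prod; apply: eq_bigr => j _; rewrite !hornerE mulrC.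
Qed.

Lemma lagrange_diag i : (lagrange_poly i).[roi_val (x i)] = 1.
Proof.
rewrite lagrange_horner big1 // => j ji; rewrite -rmorphB divff // roi_eq0 subr_eq0.
by apply: contra_neq ji => /ix.
Qed.

Lemma lagrange_offdiag i j : j != i -> (lagrange_poly i).[roi_val (x j)] = 0.
Proof. by move=> ji; rewrite lagrange_horner (bigD1 j) //= subrr !mul0r. Qed.

Lemma size_lagrange i : (size (lagrange_poly i) <= n.+1)%N.
Proof.
apply: leq_trans (size_poly_prod_leq _ _) _.
rewrite leq_subLR addnS ltnS.
apply: (@leq_trans (\sum_(j < n.+1 | j != i) 2)).
  apply: leq_sum => j _; apply: leq_trans (size_scale_leq _ _) _.
  by rewrite size_XsubC.
rewrite sum_nat_const muln2 -addnn leq_add2l.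
by rewrite (eq_card (B := predC1 i)) // cardC1 card_ord.
Qed.

Lemma lagrange_interpolation (P : {poly K}) : (size P <= n.+1)%N ->
  P = \sum_i P.[roi_val (x i)] *: lagrange_poly i.
Proof.
move=> sP; apply/eqP; rewrite -subr_eq0; apply/eqP.
apply: (@roots_geq_poly_eq0 _ _ [seq roi_val (x i) | i : 'I_n.+1]).
- apply/allP => _ /mapP[j _ ->]; apply/rootP.
  rewrite hornerD hornerN horner_sum (bigD1 j) //= hornerZ lagrange_diag mulr1.
  rewrite big1 ?addr0 ?subrr // => i ij.
  by rewrite hornerZ lagrange_offdiag ?mulr0 // eq_sym.
- by rewrite map_inj_uniq ?enum_uniq // => i j /roi_inj/ix.
- rewrite size_map -cardE card_ord (leq_trans (size_polyD _ _)) // geq_max sP size_polyN.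
  rewrite (leq_trans (size_sum _ _ _)) //; apply/bigmax_leqP => i _.
  by rewrite (leq_trans (size_scale_leq _ _)) // size_lagrange.
Qed.

Definition universal_family := forall P : {poly K}, (size P <= n.+1)%N ->
  (forall i, P.[roi_val (x i)] \in algInt K) -> forall y, P.[roi_val y] \in algInt K.

Lemma universal_familyP :
  universal_family <-> forall i y, (lagrange_poly i).[roi_val y] \in algInt K.
Proof.
split=> [univ i|lag P sP Px y]; last first.
  rewrite (lagrange_interpolation sP) horner_sum rpred_sum // => i _.
  by rewrite hornerZ; apply: rpredM; [exact: Px|exact: lag].
apply: univ; first exact: size_lagrange.
move=> j; case: (eqVneq j i) => [->|ji]; first by rewrite lagrange_diag rpred1.
by rewrite lagrange_offdiag // rpred0.
Qed.

Definition minimal_family := forall x1 : 'I_n.+1 -> OK, injective x1 ->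
  exists c, diff_prod x1 = diff_prod x * c.

(** Interpolation of the monomials X^k with k <= n factors the Vandermonde
    matrix. *)
Lemma universal_minimal : universal_family -> minimal_family.
Proof.
move=> /universal_familyP lag x1 _.
have /choice[l lE] : forall ij : 'I_n.+1 * 'I_n.+1, exists y,
    roi_val y = (lagrange_poly ij.1).[roi_val (x1 ij.2)].
  by move=> ij; apply: algInt_roi; exact: lag.
pose M : 'M[OK]_n.+1 := \matrix_(i, j) l (i, j).
have VE : Vandermonde n.+1 (\row_i x1 i) = Vandermonde n.+1 (\row_i x i) *m M.
  apply/matrixP => k j; rewrite !mxE; apply: roi_inj; rewrite rmorph_sum rmorphXn /=.
  have := lagrange_interpolation (P := 'X^k); rewrite size_polyXn => /(_ (ltn_ord k)).
  move=> /(congr1 (horner^~ (roi_val (x1 j)))); rewrite hornerXn => ->.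
  rewrite horner_sum; apply: eq_bigr => i _.
  rewrite hornerZ hornerXn !mxE; have := lE (i, j) => /= <-.
  by rewrite -rmorphXn -rmorphM.
exists (\det M ^+ 2); rewrite !diff_prod_Vandermonde VE det_mulmx exprMn.
by rewrite mulrAC.
Qed.

Lemma algInt_sqr (v : K) : v ^+ 2 \in algInt K -> v \in algInt K.
Proof.
move=> v2; apply: (@algInt_root_monic _ _ ('X^2 - (v ^+ 2)%:P)).
- by rewrite monicXnsubC.
- by rewrite rootE !(hornerE, hornerXn) subrr.
- move=> i; rewrite coefB coefXn coefC rpredB ?rpred_nat //.
  by case: ifP; rewrite ?rpred0.
Qed.

(** Moving the point of index [i] to [y] multiplies the product of differences by
    the square of the value at [y] of the Lagrange polynomial. *)
Lemma minimal_universal : minimal_family -> universal_family.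
Proof.
move=> minx; apply/universal_familyP => i y.
case: (pselect (exists2 j, j != i & y = x j)) => [[j ji ->]|yx].
  by rewrite lagrange_offdiag // rpred0.
pose x1 j := if j == i then y else x j.
have x1i : x1 i = y by rewrite /x1 eqxx.
have x1j j : j != i -> x1 j = x j by rewrite /x1 => /negPf->.
have ix1 : injective x1.
  move=> j k; rewrite /x1; case: eqVneq => [->|ji]; case: eqVneq => [->|ki] // h.
  - by case: yx; exists k.
  - by case: yx; exists j.
  - exact: ix.
have [c] := minx x1 ix1; rewrite !(diff_prodD1 _ i) x1i.
set R := \prod_(k | k != i) \prod_(j | _) (x k - x j).
have -> : \prod_(k | k != i) \prod_(j | (k != j) && (j != i)) (x1 k - x1 j) = R.
  by apply: eq_bigr => k ki; apply: eq_bigr => j /andP[_ ji]; rewrite !x1j.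
have -> : \prod_(j | j != i) (y - x1 j) = \prod_(j | j != i) (y - x j).
  by apply: eq_bigr => j /x1j->.
have -> : \prod_(j | j != i) (x1 j - y) = \prod_(j | j != i) (x j - y).
  by apply: eq_bigr => j /x1j->.
move: (diff_prod_neq0 ix); rewrite (diff_prodD1 _ i) -/R.
set A := \prod_(j | j != i) (x i - x j); set B := \prod_(j | j != i) (x j - x i).
rewrite -roi_eq0 !rmorphM /= !mulf_eq0 !negb_or => /andP[/andP[A0 B0] R0] cE.
have LA : (lagrange_poly i).[roi_val y] =
    roi_val (\prod_(j | j != i) (y - x j)) / roi_val A.
  by rewrite lagrange_horner !rmorph_prod -prodf_div.
have LB : (lagrange_poly i).[roi_val y] =
    roi_val (\prod_(j | j != i) (x j - y)) / roi_val B.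
  rewrite lagrange_horner !rmorph_prod -prodf_div; apply: eq_bigr => j _.
  by rewrite -[x j - y]opprB -[x j - x i]opprB !rmorphN /= invrN mulrNN.
apply: algInt_sqr; rewrite expr2 {1}LA LB.
suff -> : roi_val (\prod_(j | j != i) (y - x j)) / roi_val A *
          (roi_val (\prod_(j | j != i) (x j - y)) / roi_val B) = roi_val c.
  exact: roi_int.
have := congr1 (@roi_val K) cE; rewrite !rmorphM /= => {}cE.
apply: (mulIf (mulf_neq0 (mulf_neq0 A0 B0) R0)).
rewrite [RHS]mulrC -cE; field; by rewrite A0 B0.
Qed.

(** The lower bound holds for all families; conversely a minimal product divides
    the one of a family optimal at p, which bounds its valuation from above.  The
    optimal family may depend on p. *)
Lemma minimal_familyP :
  principal (diff_prod x) =
    ideal_exp (\big[ideal_mul/setT]_(1 <= i < n.+1) factorial_ideal K i) 2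
  <-> minimal_family.
Proof.
have := has_exponents_exp 2
  (has_exponents_prod (index_iota 1 n.+1) (@has_exponents_factorial K)).
set F := ideal_exp _ 2; set E := (fun p => _) => EF.
split=> [DF x1 ix1|minx].
  have : F (diff_prod x1).
    have [_ -> _ _] := EF => p np; have [d dE] := has_val_exists np (diff_prod_neq0 ix1).
    by have [h _] := dE; apply: (ideal_expW np _ h); apply: diff_prod_val_ge dE.
  by rewrite -DF => -[c _ <-]; exists c.
apply: has_exponents_inj EF; apply: has_exponents_principal; first exact: diff_prod_neq0.
move=> p np; have [d dE] := has_val_exists np (diff_prod_neq0 ix).
suff -> : E p = d by [].
apply/eqP; rewrite eqn_leq (diff_prod_val_ge np ix dE) /=.
have [x1 ix1 [_ nE]] := optimal_family np n; have [c cE] := minx x1 ix1.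
rewrite leqNgt; apply/negP => dlt; apply: nE; rewrite cE.
apply: is_idealMr; first by apply: is_ideal_exp; have [] := nz_primesP np.
by have [h _] := dE; apply: (ideal_expW np _ h).
Qed.

End Lagrange.

(** * Finite sets as families *)

Section Sets.
Local Open Scope classical_set_scope.
Local Open Scope ring_scope.
Variable K : fieldExtType rat.
Local Notation OK := (ringOfIntegers K).

Lemma vol_family n (x : 'I_n -> OK) : injective x ->
  #|` [fset x i | i in 'I_n]%fset|%fset = n /\
  vol [fset x i | i in 'I_n]%fset = principal (diff_prod x).
Proof.
move=> ix; split; first by rewrite card_imfset //= -cardE card_ord.
rewrite /vol big_imfset /= => [|? ? _ _ /ix //]; congr principal.
rewrite big_enum /diff_prod; apply: eq_bigr => i _.
rewrite big_mkcond big_imfset /= => [|? ? _ _ /ix //].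
by rewrite big_enum -big_mkcond; apply: eq_bigl => j; rewrite (inj_eq ix).
Qed.

Lemma family_of_fset n (S : {fset OK}) : #|` S|%fset = n ->
  exists2 x : 'I_n -> OK, injective x & S = [fset x i | i in 'I_n]%fset.
Proof.
move=> Sn; exists (fun i : 'I_n => nth 0 S i).
  move=> i j /eqP; rewrite nth_uniq ?fset_uniq ?Sn // => /eqP; exact: val_inj.
apply/fsetP => s; apply/idP/imfsetP => [sS|[i _ ->]]; last by rewrite mem_nth // Sn.
have iS : (index s S < n)%N by rewrite -Sn index_mem.
by exists (Ordinal iS); rewrite //= nth_index.
Qed.

Lemma ideal_dvd_principal (R : comNzRingType) (a b : R) :
  ideal_dvd (principal a) (principal b) <-> exists c, b = a * c.
Proof.
split=> [[H iH abH]|[c ->]].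
  have : principal b b by exists 1; rewrite ?mulr1.
  rewrite abH; suff sub : ideal_mul (principal a) H `<=` principal a.
    by move=> /sub[c _ <-]; exists c.
  apply: ideal_mul_sub => [|_ c [u _ <-] _]; first exact: is_ideal_principal.
  by exists (u * c); rewrite // mulrA.
exists (principal c); first exact: is_ideal_principal.
apply/seteqP; split=> [_ [y _ <-]|].
  by rewrite -mulrA; apply: mem_ideal_mul; [exists 1; rewrite ?mulr1|exists y].
apply: ideal_mul_sub; first exact: is_ideal_principal.
by move=> _ _ [u _ <-] [v _ <-]; exists (u * v); rewrite // mulrACA.
Qed.
End Sets.

Theorem proposition2p6 (K : fieldExtType rat) (n : nat)
    (S : {fset (ringOfIntegers K)}) (hS : #|` S|%fset = n.+1) :
  (n_optimal n S <->
     vol S = ideal_exp (\big[ideal_mul/setT]_(1 <= i < n.+1)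
                          factorial_ideal K i) 2) /\
  (vol S = ideal_exp (\big[ideal_mul/setT]_(1 <= i < n.+1)
                        factorial_ideal K i) 2 <->
     forall S1 : {fset (ringOfIntegers K)}, #|` S1|%fset = n.+1 ->
       ideal_dvd (vol S) (vol S1)).
Proof.
have [x ix SE] := family_of_fset hS.
have [_ volS] := vol_family ix; rewrite -SE in volS.
have optP : n_optimal n S <-> universal_family x.
  split=> [[univ _] P sP Px|univ].
    by apply/(univ P sP) => s; rewrite SE => /imfsetP[i _ ->].
  split=> // P sP; split=> [int s _|int]; first exact: int.
  by apply: univ => // i; apply: int; rewrite SE; apply/imfsetP; exists i.
have minP : (forall S1 : {fset (ringOfIntegers K)}, #|` S1|%fset = n.+1 ->
    ideal_dvd (vol S) (vol S1)) <-> minimal_family x.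
  split=> [dvdS x1 ix1|minx S1 hS1].
    have [card1 vol1] := vol_family ix1.
    by apply/ideal_dvd_principal; rewrite -volS -vol1; apply: dvdS.
  have [x1 ix1 SE1] := family_of_fset hS1; have [_ vol1] := vol_family ix1.
  by rewrite volS SE1 vol1; apply/ideal_dvd_principal; apply: minx.
rewrite optP minP volS minimal_familyP //; split=> //.
by split; [exact: universal_minimal|exact: minimal_universal].
Qed.
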